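(* Fix a variable layout, i.e. numbers $M\ge1$, $N\ge0$, $M_i,N_j\ge0$ and assertion variables $a_{i,k}$ ($1\le k\le M_i$), $b_{j,k}$ ($1\le k\le N_j$) with every $b_{j,k}$ among the $a_{i,k}$. Let $L=\{(i,j)\mid1\le i\le M,1\le j\le N\}$. Suppose the layout satisfies none of the following three criteria: (Shadow) both (S1): for all $(i,j)\in L$ with $\Pi(i)\not\ge\Omega(j)$ there is $c\in V$ with $\Pi(i)(c)<\Omega(j)(c)$ and $\Pi(k)(c)=\Omega(l)(c)$ for all $(k,l)\in L$ with $\Pi(k)\ge\Omega(l)$; and (S2): for all $1\le j\le N$ there is $c\in V$ with $\Omega(j)(c)>0$ and $\Pi(k)(c)=\Omega(l)(c)$ for all $(k,l)\in L$ with $\Pi(k)\ge\Omega(l)$; (Balloon) there is $B\subseteq V$ with $\sum_{c\in B}\Pi(i)(c)\le1$ for all $i$; for all $j$, $\sum_{c\in V}\Omega(j)(c)=0$ or $\sum_{c\in B}\Omega(j)(c)=1$; and for all $(i,j)\in L$ with $\Pi(i)\not\ge\Omega(j)$ some $c\in B$ has $\Pi(i)(c)<\Omega(j)(c)$; (Lonely) $M=1$ and $\Pi(1)\ge\Omega(j)$ for all $1\le j\le N$. Then there exist assertions $\varphi_1,\dots,\varphi_M,\psi_1,\dots,\psi_N$ containing no assertion variables such that the implication $\bigwedge_{i}\varphi_i*a_{i,1}*\cdots*a_{i,M_i}\Rightarrow\bigvee_j\psi_j*b_{j,1}*\cdots*b_{j,N_j}$ holds in the unary interpretation ($\models^1$)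 but not in the binary interpretation ($\not\models^2$).
   Context: $\mathsf{Heap}$: finite partial functions $\mathsf{PosInt}\to\mathsf{Int}$; $g\sqsubseteq h$ means $h$ extends $g$; $h\cdot g$ union of disjoint heaps; componentwise on $\mathsf{Heap}^n$. $\mathsf{IRel}_n$: upward closed subsets of $\mathsf{Heap}^n$; $p*q=\{\mathbf f\cdot\mathbf g\mid\mathbf f\in p,\mathbf g\in q,\text{componentwise disjoint}\}$; $\Delta_n(X)=\{(h_1,\dots,h_n)\mid\exists f\in X.\ \forall k.\ f\sqsubseteq h_k\}$. Assertions: built from primitive assertions $P$ (e.g. $E\hookrightarrow F$), assertion variables, $\mathsf{true},\mathsf{false},\wedge,\vee,*$, quantifiers over integer variables. $n$-ary meaning under $\eta$ (ordinary variables to integers) and $\rho:\mathsf{AVar}\to\mathsf{IRel}_n$: $[\![P]\!]^n=\Delta_n([\![P]\!]^{\mathrm{prim}}_\eta)$ with the standard meaning $[\![P]\!]^{\mathrm{prim}}_\eta\subseteq\mathsf{Heap}$, $[\![a]\!]^n=\rho(a)$, connectives by $\mathsf{Heap}^n,\emptyset,\cap,\cup,*$, quantifiers by unions/intersections. $\varphi\models^n\psi$ means $[\![\varphi]\!]^n_{\eta,\rho}\subseteq[\![\psi]\!]^n_{\eta,\rho}$ for all $\eta$ and all $\rho:\mathsf{AVar}\to\mathsf{IRel}_n$. $V=\{a_{i,k}\}$; $\Pi(i)(c)=|\{k\mid a_{i,k}=c\}|$, $\Omega(j)(c)=|\{k\mid b_{j,k}=c\}|$ for $c\in V$; $\Pi(i)\ge\Omega(j)$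 iff $\Pi(i)(c)\ge\Omega(j)(c)$ for all $c\in V$, and $\Pi(i)\not\ge\Omega(j)$ otherwise. *)

(* Defs.v *)
From Stdlib Require Import ZArith List Arith Lia Fin.
Import ListNotations.
Open Scope Z_scope.

Definition is_finite (h : positive -> option Z) : Prop :=
  exists l : list positive, forall p v, h p = Some v -> In p l.

Definition heap := { h : positive -> option Z | is_finite h }.
Definition hget (h : heap) (p : positive) : option Z := proj1_sig h p.

Definition extends (g h : heap) : Prop :=
  forall p v, hget g p = Some v -> hget h p = Some v.

Definition disjoint (f g : heap) : Prop :=
  forall p, hget f p = None \/ hget g p = None.

Definition is_union (f g h : heap) : Prop :=
  forall p, hget h p = match hget f p with Some v => Some v | None => hget g p end.

Definition heapn (n : nat) := Fin.t n -> heap.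

Definition upclosed {n : nat} (p : heapn n -> Prop) : Prop :=
  forall hs hs', (forall k, extends (hs k) (hs' k)) -> p hs -> p hs'.
Definition IRel (n : nat) := { p : heapn n -> Prop | upclosed p }.

Inductive expr : Type :=
| EVar (x : nat)
| EConst (z : Z)
| EAdd (e1 e2 : expr)
| ESub (e1 e2 : expr)
| EMul (e1 e2 : expr).

Fixpoint eval (eta : nat -> Z) (e : expr) : Z :=
  match e with
  | EVar x => eta x
  | EConst z => z
  | EAdd a b => eval eta a + eval eta b
  | ESub a b => eval eta a - eval eta b
  | EMul a b => eval eta a * eval eta b
  end.

Inductive prim : Type :=
| PPointsTo (E F : expr)
| PEq (E F : expr).

Definition prim_sem (eta : nat -> Z) (P : prim) (h : heap) : Prop :=
  match P with
  | PPointsTo E F => 0 < eval eta E /\ hget h (Z.to_pos (eval eta E)) = Some (eval eta F)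
  | PEq E F => eval eta E = eval eta F
  end.

Inductive assertion : Type :=
| APrim (P : prim)
| AVar (a : nat)
| ATrue
| AFalse
| AAnd (p q : assertion)
| AOr (p q : assertion)
| AStar (p q : assertion)
| AEx (x : nat) (p : assertion)
| AAll (x : nat) (p : assertion).

Definition upd (eta : nat -> Z) (x : nat) (v : Z) : nat -> Z :=
  fun y => if Nat.eqb y x then v else eta y.

Definition Delta (n : nat) (X : heap -> Prop) (hs : heapn n) : Prop :=
  exists f, X f /\ forall k, extends f (hs k).

Definition starn {n : nat} (p q : heapn n -> Prop) (hs : heapn n) : Prop :=
  exists fs gs, p fs /\ q gs /\
    forall k, disjoint (fs k) (gs k) /\ is_union (fs k) (gs k) (hs k).

Fixpoint sem (n : nat) (eta : nat -> Z) (rho : nat -> IRel n) (phi : assertion)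
  : heapn n -> Prop :=
  match phi with
  | APrim P => Delta n (prim_sem eta P)
  | AVar a => proj1_sig (rho a)
  | ATrue => fun _ => True
  | AFalse => fun _ => False
  | AAnd p q => fun hs => sem n eta rho p hs /\ sem n eta rho q hs
  | AOr p q => fun hs => sem n eta rho p hs \/ sem n eta rho q hs
  | AStar p q => starn (sem n eta rho p) (sem n eta rho q)
  | AEx x p => fun hs => exists v, sem n (upd eta x v) rho p hs
  | AAll x p => fun hs => forall v, sem n (upd eta x v) rho p hs
  end.

Definition models (n : nat) (phi psi : assertion) : Prop :=
  forall (eta : nat -> Z) (rho : nat -> IRel n) (hs : heapn n),
    sem n eta rho phi hs -> sem n eta rho psi hs.

Fixpoint no_avar (phi : assertion) : Prop :=
  match phi with
  | APrim _ | ATrue | AFalse => True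
  | AVar _ => False
  | AAnd p q | AOr p q | AStar p q => no_avar p /\ no_avar q
  | AEx _ p | AAll _ p => no_avar p
  end.

(** * Variable layouts
    A layout is given by A = [a_1; ...; a_M] with a_i = [a_{i,1}; ...; a_{i,M_i}]
    and B = [b_1; ...; b_N] with b_j = [b_{j,1}; ...; b_{j,N_j}].
    Indices i, j are 0-based in the formalization. *)
Definition layout_ok (A B : list (list nat)) : Prop :=
  (1 <= length A)%nat /\
  forall j b, (j < length B)%nat -> In b (nth j B []) ->
    exists i, (i < length A)%nat /\ In b (nth i A []).

Definition Vset (A : list (list nat)) : list nat := nodup Nat.eq_dec (concat A).

Definition Pi (A : list (list nat)) (i : nat) (c : nat) : nat :=
  count_occ Nat.eq_dec (nth i A []) c.
Definition Omega (B : list (list nat)) (j : nat) (c : nat) : nat :=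
  count_occ Nat.eq_dec (nth j B []) c.

Definition PiGe (A B : list (list nat)) (i j : nat) : Prop :=
  forall c, In c (Vset A) -> (Omega B j c <= Pi A i c)%nat.

Definition inL (A B : list (list nat)) (k l : nat) : Prop :=
  (k < length A)%nat /\ (l < length B)%nat.

Definition balanced (A B : list (list nat)) (c : nat) : Prop :=
  forall k l, inL A B k l -> PiGe A B k l -> Pi A k c = Omega B l c.

Definition S1 (A B : list (list nat)) : Prop :=
  forall i j, inL A B i j -> ~ PiGe A B i j ->
    exists c, In c (Vset A) /\ (Pi A i c < Omega B j c)%nat /\ balanced A B c.

Definition S2 (A B : list (list nat)) : Prop :=
  forall j, (j < length B)%nat ->
    exists c, In c (Vset A) /\ (0 < Omega B j c)%nat /\ balanced A B c.

Definition Shadow (A B : list (list nat)) : Prop := S1 A B /\ S2 A B.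

Definition sumover (s : list nat) (f : nat -> nat) : nat :=
  fold_right (fun c acc => (f c + acc)%nat) 0%nat s.

Definition Balloon (A B : list (list nat)) : Prop :=
  exists Bs : list nat,
    NoDup Bs /\ incl Bs (Vset A) /\
    (forall i, (i < length A)%nat -> (sumover Bs (Pi A i) <= 1)%nat) /\
    (forall j, (j < length B)%nat ->
        sumover (Vset A) (Omega B j) = 0%nat \/ sumover Bs (Omega B j) = 1%nat) /\
    (forall i j, inL A B i j -> ~ PiGe A B i j ->
        exists c, In c Bs /\ (Pi A i c < Omega B j c)%nat).

Definition Lonely (A B : list (list nat)) : Prop :=
  length A = 1%nat /\ forall j, (j < length B)%nat -> PiGe A B 0 j.

Definition star_vars (phi : assertion) (as_ : list nat) : assertion :=
  fold_left (fun acc a => AStar acc (AVar a)) as_ phi.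

Definition lhs (phis : list assertion) (A : list (list nat)) : assertion :=
  fold_right AAnd ATrue (map (fun pa => star_vars (fst pa) (snd pa)) (combine phis A)).

Definition rhs (psis : list assertion) (B : list (list nat)) : assertion :=
  fold_right AOr AFalse (map (fun pb => star_vars (fst pb) (snd pb)) (combine psis B)).

(* Main.v *)
Require Import Defs.
From Stdlib Require Import ZArith List Arith Lia Classical ClassicalEpsilon Cantor.
Import ListNotations.
Local Open Scope nat_scope.

(** A variable-free assertion holds of a pair of heaps iff it holds of their intersection, so it
    may be taken to require a fixed set of cells.  A binary counterexample is then a choice, for
    every conjunct [i], of which common cells are hidden in which of its pieces; further addresses
    with different values in the two heaps force a selection of pieces for a disjunct to come from
    a single conjunct.  The unary implication becomes a game: an adversary splits one heap for
    every conjunct, and must be shown unable to avoid that some disjunct selects disjoint pieces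
    whose removal leaves an address that is not a cell, or all the cells this disjunct asks for.

    Write [j <= i] for [Pi(i) >= Omega(j)], and call [c] full in [j <= i] if
    [Omega(j)(c) = Pi(i)(c) > 0].  If [M >= 2] and, for some [i], no
    variable is full in all nonempty [j <= i], few cells shared between pieces of row [i] suffice.
    Otherwise each row hides one cell in a piece of its common full variable (no cells are used if
    [M = 1], or if (S2) fails and some [j] is below no [i]).  Then an unbalanced variable always has an empty piece
    somewhere.  Failure of (S2) thus forces all pieces into the cells, and the variables all of
    whose pieces are nonempty form a balloon set; under failure of (S1) at [(i, j)], disjunct [j]
    takes its pieces from row [i] and its deficient variables from empty pieces. *)

(** * Heaps and the semantics of assertions *)

Lemma hfilter_finite (P : positive -> bool) (h : heap) :
  is_finite (fun p => if P p then hget h p else None).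
Proof.
  destruct h as [h [l Hl]]. exists l. intros p v H. cbn in H.
  destruct (P p); [eapply Hl, H | discriminate].
Qed.

Definition hfilter (P : positive -> bool) (h : heap) : heap :=
  exist _ _ (hfilter_finite P h).

Definition is_none (o : option Z) : bool :=
  match o with Some _ => false | None => true end.

(** The remainder left for a variable-free assertion once the pieces [ps] are removed. Since
    meanings are upward closed, this largest remainder can replace any other. *)
Definition minus {n} (hs : heapn n) (ps : list (heapn n)) : heapn n :=
  fun k => hfilter (fun p => forallb (fun f => is_none (hget (f k) p)) ps) (hs k).

Lemma hget_minus {n} (hs : heapn n) ps k p v :
  hget (minus hs ps k) p = Some v <->
  hget (hs k) p = Some v /\ forall f, In f ps -> hget (f k) p = None.
Proof.
  unfold minus, hget at 1; cbn.
  destruct (forallb (fun f => is_none (hget (f k) p)) ps) eqn:E.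
  - rewrite forallb_forall in E. split; [intros H; split; [exact H|] | intros [H _]; exact H].
    intros f Hf. specialize (E f Hf). cbn in E. now destruct (hget (f k) p).
  - split; [discriminate|]. intros [H H']. exfalso.
    rewrite <- Bool.not_true_iff_false, forallb_forall in E. apply E.
    intros f Hf. now rewrite H'.
Qed.

Definition subheap {n} (fs hs : heapn n) : Prop := forall k, extends (fs k) (hs k).

Definition apart {n} (fs gs : heapn n) : Prop := forall k, disjoint (fs k) (gs k).

Lemma minus_subheap {n} (hs : heapn n) ps : subheap (minus hs ps) hs.
Proof. intros k p v H. now apply hget_minus in H. Qed.

Lemma minus_union {n} (fs hs : heapn n) :
  subheap fs hs ->
  forall k, disjoint (fs k) (minus hs [fs] k) /\ is_union (fs k) (minus hs [fs] k) (hs k).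
Proof.
  intros H k. split.
  - intros p. destruct (hget (fs k) p) as [v|] eqn:E; [right | now left].
    destruct (hget (minus hs [fs] k) p) as [w|] eqn:F; [|easy].
    apply hget_minus in F as [_ F]. rewrite (F fs (or_introl eq_refl)) in E. discriminate.
  - intros p. destruct (hget (fs k) p) as [v|] eqn:E; [now apply H|].
    destruct (hget (hs k) p) as [v|] eqn:F.
    + symmetry. apply hget_minus. split; [easy|]. intros f [<-|[]]. exact E.
    + destruct (hget (minus hs [fs] k) p) as [v|] eqn:G; [|easy].
      apply hget_minus in G as [G _]. congruence.
Qed.

Lemma union_subheap {n} (fs gs hs : heapn n) :
  (forall k, disjoint (fs k) (gs k) /\ is_union (fs k) (gs k) (hs k)) ->
  subheap fs hs /\ subheap gs hs.
Proof.
  intros H; split; intros k p v E; destruct (H k) as [D U]; rewrite (U p).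
  - now rewrite E.
  - destruct (D p) as [->|D']; congruence.
Qed.

Lemma sem_upclosed n phi : forall eta rho, upclosed (sem n eta rho phi).
Proof.
  induction phi as [P|a| | |p IHp q IHq|p IHp q IHq|p IHp q IHq|x p IHp|x p IHp];
    intros eta rho hs hs' Hext; cbn.
  - intros (f & Hf & He). exists f. split; [exact Hf|]. intros k r v E. now apply Hext, He.
  - now apply (proj2_sig (rho a)).
  - easy.
  - easy.
  - intros [Hp Hq]; split; [eapply IHp | eapply IHq]; eauto.
  - intros [Hp|Hq]; [left; eapply IHp | right; eapply IHq]; eauto.
  (* The first factor keeps its heaps; the second absorbs all that the extension adds. *)
  - intros (fs & gs & Hp & Hq & Hu). destruct (union_subheap _ _ _ Hu) as [Hf Hg].
    exists fs, (minus hs' [fs]). split; [exact Hp|]. split.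
    + refine (IHq _ _ gs _ _ Hq). intros k r v E. apply hget_minus. split.
      * now apply Hext, Hg.
      * intros f [<-|[]]. destruct (proj1 (Hu k) r) as [D|D]; [exact D | congruence].
    + apply minus_union. intros k r v E. now apply Hext, Hf.
  - intros [v Hv]. exists v. eapply IHp; eauto.
  - intros Hv v. eapply IHp; eauto.
Qed.

(** By upward closure the factor for [phi] may be the whole complement of the pieces, so only the
    pieces of the variables have to be recorded. *)
Lemma sem_star_vars n eta rho l : forall phi hs,
  sem n eta rho (star_vars phi l) hs <->
  exists ps, Forall2 (fun a f => proj1_sig (rho a) f) l ps /\
    ForallOrdPairs apart ps /\ Forall (fun f => subheap f hs) ps /\
    sem n eta rho phi (minus hs ps).
Proof.
  induction l as [|a l IH]; intros phi hs; cbn [star_vars fold_left].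
  - split.
    + intros H. exists []. repeat split; try constructor.
      refine (sem_upclosed _ _ _ _ hs _ _ H). intros k p v E. now apply hget_minus.
    + intros (ps & _ & _ & _ & H). refine (sem_upclosed _ _ _ _ _ _ _ H). apply minus_subheap.
  - change (fold_left _ l (AStar phi (AVar a))) with (star_vars (AStar phi (AVar a)) l).
    rewrite IH. split.
    + intros (ps & HF & HP & HS & fs & gs & Hf & Hg & Hu).
      destruct (union_subheap _ _ _ Hu) as [Sf Sg].
      exists (gs :: ps). split; [now constructor|]. split; [|split].
      * constructor; [|exact HP]. apply Forall_forall. intros f Hf' k p.
        destruct (hget (gs k) p) as [v|] eqn:E; [right | now left].
        apply Sg, hget_minus in E as [_ E]. auto.
      * constructor; [|exact HS]. intros k p v E. now apply Sg, hget_minus in E.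
      * refine (sem_upclosed _ _ _ _ fs _ _ Hf). intros k p v E.
        pose proof (Sf k p v E) as E'. apply hget_minus in E' as [E1 E2].
        apply hget_minus. split; [exact E1|]. intros f [<-|Hin]; [|auto].
        destruct (proj1 (Hu k) p) as [D|D]; [congruence | exact D].
    + intros (ps' & HF & HP & HS & H). inversion HF as [|? p0 ? ps Hp0 HF']; subst.
      inversion HP as [|? ? HP1 HP2]; subst. inversion HS as [|? ? HS1 HS2]; subst.
      exists ps. repeat split; try assumption.
      exists (minus hs (p0 :: ps)), p0. split; [exact H|]. split; [exact Hp0|].
      rewrite Forall_forall in HP1.
      intros k. split; intros p.
      * destruct (hget (minus hs (p0 :: ps) k) p) as [v|] eqn:E; [right | now left].
        apply hget_minus in E as [_ E]. apply E. now left.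
      * destruct (hget (minus hs (p0 :: ps) k) p) as [v|] eqn:E.
        -- apply hget_minus in E as [E1 E2]. apply hget_minus. split; [exact E1|].
           intros f Hf. apply E2. now right.
        -- destruct (hget (p0 k) p) as [v|] eqn:E0.
           ++ apply hget_minus. split; [now apply HS1|]. intros f Hf.
              destruct (HP1 f Hf k p) as [D|D]; [congruence | exact D].
           ++ destruct (hget (minus hs ps k) p) as [v|] eqn:E1; [|easy].
              apply hget_minus in E1 as [E1 E2]. rewrite <- E. symmetry. apply hget_minus.
              split; [exact E1|]. intros f [<-|Hf]; auto.
Qed.

Lemma sem_lhs n eta rho phi A hs :
  sem n eta rho (lhs (map phi (seq 0 (length A))) A) hs <->
  forall i, i < length A -> sem n eta rho (star_vars (phi i) (nth i A [])) hs.
Proof.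
  unfold lhs. cut (forall s, sem n eta rho (fold_right AAnd ATrue
      (map (fun pa => star_vars (fst pa) (snd pa)) (combine (map phi (seq s (length A))) A))) hs <->
    forall i, i < length A -> sem n eta rho (star_vars (phi (s + i)) (nth i A [])) hs).
  { intros H. apply (H 0). }
  induction A as [|a A IH]; intros s; cbn.
  - split; [lia | easy].
  - rewrite IH. split.
    + intros [H1 H2] [|i] Hi; [now rewrite Nat.add_0_r|].
      specialize (H2 i). rewrite <- Nat.add_succ_comm. apply H2. lia.
    + intros H. split; [specialize (H 0); rewrite Nat.add_0_r in H; apply H; lia|].
      intros i Hi. specialize (H (S i)). rewrite <- Nat.add_succ_comm in H. apply H. lia.
Qed.

Lemma sem_rhs n eta rho psi B hs :
  sem n eta rho (rhs (map psi (seq 0 (length B))) B) hs <->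
  exists j, j < length B /\ sem n eta rho (star_vars (psi j) (nth j B [])) hs.
Proof.
  unfold rhs. cut (forall s, sem n eta rho (fold_right AOr AFalse
      (map (fun pb => star_vars (fst pb) (snd pb)) (combine (map psi (seq s (length B))) B))) hs <->
    exists j, j < length B /\ sem n eta rho (star_vars (psi (s + j)) (nth j B [])) hs).
  { intros H. apply (H 0). }
  induction B as [|b B IH]; intros s; cbn.
  - split; [easy | intros (j & Hj & _); lia].
  - rewrite IH. split.
    + intros [H|(j & Hj & H)].
      * exists 0. rewrite Nat.add_0_r. split; [lia | exact H].
      * exists (S j). rewrite <- Nat.add_succ_comm. split; [lia | exact H].
    + intros ([|j] & Hj & H); [left; now rewrite Nat.add_0_r in H|].
      right. exists j. rewrite <- Nat.add_succ_comm in H. split; [lia | exact H].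
Qed.

(** * Cells and addresses outside them *)

Definition addr (x : nat) : positive := Pos.of_succ_nat x.

(** Naturals serve as addresses, [x] standing for the positive [x + 1]; the bound [b] makes the
    domain finite. *)
Definition heap_fun (b : nat) (f : nat -> option Z) (p : positive) : option Z :=
  let x := Nat.pred (Pos.to_nat p) in if x <? b then f x else None.

Lemma addr_pred p : addr (Nat.pred (Pos.to_nat p)) = p.
Proof. unfold addr. pose proof (Pos2Nat.is_pos p). apply Pos2Nat.inj. rewrite SuccNat2Pos.id_succ. lia. Qed.

Lemma pred_addr x : Nat.pred (Pos.to_nat (addr x)) = x.
Proof. unfold addr. now rewrite SuccNat2Pos.id_succ. Qed.

Lemma heap_fun_finite b f : is_finite (heap_fun b f).
Proof.
  exists (map addr (seq 0 b)). intros p v H. unfold heap_fun in H.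
  destruct (Nat.ltb_spec (Nat.pred (Pos.to_nat p)) b) as [L|L]; [|discriminate].
  rewrite <- (addr_pred p). apply in_map, in_seq. lia.
Qed.

Definition heap_of b f : heap := exist _ _ (heap_fun_finite b f).

Lemma hget_heap_of b f x : hget (heap_of b f) (addr x) = if x <? b then f x else None.
Proof. unfold heap_of, hget, heap_fun; cbn -[Nat.ltb Nat.pred]. now rewrite pred_addr. Qed.

Lemma sem_pointsto n eta rho E F (hs : heapn n) :
  0 < n ->
  (sem n eta rho (APrim (PPointsTo E F)) hs <->
   (0 < eval eta E)%Z /\ forall k, hget (hs k) (Z.to_pos (eval eta E)) = Some (eval eta F)).
Proof.
  intros Hn. cbn. split.
  - intros (f & [H1 H2] & H3). split; [exact H1|]. intros k. now apply H3.
  - intros [H1 H2]. set (x := Nat.pred (Pos.to_nat (Z.to_pos (eval eta E)))).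
    assert (Hx : addr x = Z.to_pos (eval eta E)) by apply addr_pred.
    exists (heap_of (S x) (fun y => if y =? x then Some (eval eta F) else None)).
    split.
    + split; [exact H1|]. rewrite <- Hx, hget_heap_of.
      destruct (Nat.ltb_spec x (S x)); [|lia]. now rewrite Nat.eqb_refl.
    + intros k p v. rewrite <- (addr_pred p), hget_heap_of.
      destruct (_ <? _); [|discriminate]. destruct (Nat.eqb_spec (Nat.pred (Pos.to_nat p)) x) as [e|]; [|discriminate].
      intros [= <-]. rewrite e, Hx. apply H2.
Qed.

Lemma sem_eq n eta rho E F (hs : heapn n) :
  sem n eta rho (APrim (PEq E F)) hs <-> eval eta E = eval eta F.
Proof.
  cbn. split; [now intros (f & H & _)|]. intros H.
  exists (heap_of 0 (fun _ => None)). split; [exact H|]. intros k p v.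
  rewrite <- (addr_pred p), hget_heap_of. cbn. discriminate.
Qed.

Definition cell (x : nat) : assertion := APrim (PPointsTo (EConst (Zpos (addr x))) (EConst 0)).

Definition cells (xs : list nat) : assertion := fold_right AAnd ATrue (map cell xs).

Lemma sem_cells n eta rho xs (hs : heapn n) :
  0 < n ->
  (sem n eta rho (cells xs) hs <->
   forall x, In x xs -> forall k, hget (hs k) (addr x) = Some 0%Z).
Proof.
  intros Hn. induction xs as [|x xs IH]; cbn [cells map fold_right In]; [easy|].
  change (sem n eta rho (AAnd (cell x) (cells xs)) hs <-> forall y, x = y \/ In y xs ->
    forall k, hget (hs k) (addr y) = Some 0%Z).
  change (sem n eta rho (cell x) hs /\ sem n eta rho (cells xs) hs <-> forall y, x = y \/ In y xs ->
    forall k, hget (hs k) (addr y) = Some 0%Z).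
  rewrite IH. unfold cell. rewrite sem_pointsto by exact Hn. cbn [eval Z.to_pos].
  split; [intros [[_ H1] H2] y [<-|Hy]; auto|]. intros H. repeat split; auto.
Qed.

Lemma cells_no_avar xs : no_avar (cells xs).
Proof. induction xs; cbn; auto. Qed.

(* [PEq] is the only comparison available; an integer is nonzero iff it is a product of an
   odd number and a number that is not a multiple of 3. *)
Lemma nonzero_factorization (z : Z) :
  z <> 0%Z -> exists u w, z = ((2 * u - 1) * (3 * w - 1))%Z.
Proof.
  remember (Z.abs_nat z) as m eqn:Hm. revert z Hm.
  induction m as [m IH] using lt_wf_ind. intros z -> Hz.
  destruct (Z.Even_or_Odd z) as [[y Hy]|[y Hy]].
  - destruct (IH (Z.abs_nat y)) with (z := y) as (u & w & E); try lia.
    (* The odd factor changes sign, and [3 * w - 1] is multiplied by -2, which preserves its residue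
       2 modulo 3. *)
    exists (1 - u)%Z, (1 - 2 * w)%Z. rewrite Hy, E. ring.
  - exists (- y)%Z, 0%Z. lia.
Qed.

(** As a polynomial in variable 0 it vanishes exactly at the addresses of the cells, so not being a
    cell becomes a single disequation. *)
Fixpoint prod_below (n : nat) : expr :=
  match n with
  | O => EConst 1
  | S m => EMul (prod_below m) (ESub (EVar 0) (EConst (Zpos (addr m))))
  end.

Lemma eval_prod_below n eta p :
  eta 0 = Zpos p ->
  (eval eta (prod_below n) <> 0%Z <-> forall x, x < n -> p <> addr x).
Proof.
  intros Hp. induction n as [|n IH]; cbn; [split; [lia | easy]|].
  rewrite Hp. split.
  - intros H x Hx ->. assert (Hx' : x = n \/ x < n) by lia. destruct Hx' as [->|Hx'].
    + apply H. unfold addr. lia.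
    + apply IH in Hx'; [easy|]. intros E. apply H. rewrite E. ring.
  - intros H E. apply Zmult_integral in E as [E|E].
    + revert E. apply IH. intros x Hx. apply H. lia.
    + apply (H n); [lia|]. lia.
Qed.

(** Variables 0 and 1 are an address and its contents; variables 2 and 3 supply the factorization
    that certifies the product to be nonzero. *)
Definition outside (n : nat) : assertion :=
  AEx 0 (AEx 1 (AEx 2 (AEx 3 (AAnd
    (APrim (PPointsTo (EVar 0) (EVar 1)))
    (APrim (PEq (prod_below n)
      (EMul (ESub (EMul (EConst 2) (EVar 2)) (EConst 1))
            (ESub (EMul (EConst 3) (EVar 3)) (EConst 1))))))))).

Lemma eval_prod_below_ext n eta eta' :
  eta 0 = eta' 0 -> eval eta (prod_below n) = eval eta' (prod_below n).
Proof. intros H. induction n as [|n IH]; cbn; congruence. Qed.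

Lemma sem_outside m eta rho n (hs : heapn m) :
  0 < m ->
  (sem m eta rho (outside n) hs <->
   exists x v, n <= x /\ forall k, hget (hs k) (addr x) = Some v).
Proof.
  intros Hm. unfold outside. cbn [sem]. split.
  - intros (a & v & u & w & H1 & H2).
    apply (sem_pointsto m _ rho _ _ hs Hm) in H1. cbn in H1. destruct H1 as [Ha H1].
    apply (sem_eq m _ rho _ _ hs) in H2. cbn [eval] in H2.
    destruct a as [|p|p]; try lia. cbn in H1.
    exists (Nat.pred (Pos.to_nat p)), v. rewrite addr_pred. split; [|exact H1].
    destruct (le_lt_dec n (Nat.pred (Pos.to_nat p))) as [L|L]; [exact L|]. exfalso.
    generalize (eq_sym (addr_pred p)). revert L. generalize (Nat.pred (Pos.to_nat p)).
    apply (eval_prod_below n (upd (upd (upd (upd eta 0 (Zpos p)) 1 v) 2 u) 3 w) p eq_refl).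
    rewrite H2. unfold upd; cbn [Nat.eqb]. intros E0. apply Zmult_integral in E0. lia.
  - intros (x & v & Hx & H).
    assert (Hz : eval (fun _ => Zpos (addr x)) (prod_below n) <> 0%Z).
    { apply (eval_prod_below n _ (addr x) eq_refl). intros y Hy E.
      apply (f_equal (fun p => Nat.pred (Pos.to_nat p))) in E. rewrite !pred_addr in E. lia. }
    destruct (nonzero_factorization _ Hz) as (u & w & E).
    exists (Zpos (addr x)), v, u, w. split.
    + apply (sem_pointsto m _ rho _ _ hs Hm). cbn. split; [lia | exact H].
    + apply (sem_eq m _ rho _ _ hs). rewrite (eval_prod_below_ext _ _ (fun _ => Zpos (addr x))) by reflexivity.
      rewrite E. reflexivity.
Qed.

(** * Designs *)

Definition is_piece (A : list (list nat)) (u : nat * nat) : Prop :=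
  fst u < length A /\ snd u < length (nth (fst u) A []).

Definition piece_var (A : list (list nat)) (u : nat * nat) : nat :=
  nth (snd u) (nth (fst u) A []) 0.

(** Pieces may come from different rows and may repeat, which is harmless for empty ones; [wins]
    adds disjointness. *)
Definition selection (A B : list (list nat)) (j : nat) (sel : list (nat * nat)) : Prop :=
  Forall2 (fun b u => is_piece A u /\ piece_var A u = b) (nth j B []) sel.

Definition row_selection (A B : list (list nat)) (j i : nat) (sel : list nat) : Prop :=
  NoDup sel /\
  Forall2 (fun b p => p < length (nth i A []) /\ nth p (nth i A []) 0 = b) (nth j B []) sel.

(* A design has [n] cells.  [tau i x = None] puts cell [x] into [phi_i]; [tau i x = Some (p, q)]
   puts it into the pieces [(i, p)] of the first and [(i, q)] of the second heap.  [psi_j] asks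
   for an address that is not a cell, or for all cells in [T j]. *)
Definition row_assertion (n : nat) (tau : nat -> nat -> option (nat * nat)) (i : nat) : assertion :=
  cells (filter (fun x => match tau i x with None => true | Some _ => false end) (seq 0 n)).

Definition goal_assertion (n : nat) (T : nat -> option (list nat)) (j : nat) : assertion :=
  AOr (match T j with Some t => cells t | None => AFalse end) (outside n).

(* What a heap satisfying the left-hand side looks like in the unary interpretation:
   [H] is its domain and [F u] the domain of piece [u]. *)
Definition splitting (A : list (list nat)) (n : nat) (tau : nat -> nat -> option (nat * nat))
    (F : nat * nat -> nat -> Prop) (H : nat -> Prop) : Prop :=
  (forall x, x < n -> H x) /\
  (forall u x, is_piece A u -> F u x -> H x) /\
  (forall u x, is_piece A u -> F u x -> x < n -> tau (fst u) x <> None) /\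
  (forall i p q x, is_piece A (i, p) -> is_piece A (i, q) -> F (i, p) x -> F (i, q) x -> p = q).

(** The answer sought to a splitting. Its two final alternatives match [outside] and [cells] in
    [goal_assertion]. *)
Definition wins (A B : list (list nat)) (n : nat) (T : nat -> option (list nat))
    (F : nat * nat -> nat -> Prop) (H : nat -> Prop) : Prop :=
  exists j sel, j < length B /\ selection A B j sel /\
    ForallOrdPairs (fun u v => forall x, F u x -> F v x -> False) sel /\
    ((exists x, n <= x /\ H x /\ forall u, In u sel -> ~ F u x) \/
     (exists t, T j = Some t /\ forall x u, In x t -> In u sel -> ~ F u x)).

(** Removing a cell from one of the two heaps already removes it from their intersection, hence the
    disjunction on [p] and [q]. *)
Definition hits (A B : list (list nat)) (tau : nat -> nat -> option (nat * nat))
    (T : nat -> option (list nat)) : Prop :=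
  forall j t i sel, j < length B -> T j = Some t -> i < length A ->
    row_selection A B j i sel ->
    exists x p q, In x t /\ tau i x = Some (p, q) /\ (In p sel \/ In q sel).

Definition separable (A B : list (list nat)) : Prop :=
  exists (phis psis : list assertion),
    length phis = length A /\ length psis = length B /\
    Forall no_avar phis /\ Forall no_avar psis /\
    models 1 (lhs phis A) (rhs psis B) /\
    ~ models 2 (lhs phis A) (rhs psis B).

Lemma fin1 (k : Fin.t 1) : k = Fin.F1.
Proof. apply (Fin.caseS' k); [reflexivity | intros p; inversion p]. Qed.

Lemma ForallOrdPairs_map {X Y} (f : X -> Y) (R : Y -> Y -> Prop) l :
  ForallOrdPairs (fun x y => R (f x) (f y)) l -> ForallOrdPairs R (map f l).
Proof.
  induction 1 as [|x l H _ IH]; cbn; constructor; auto.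
  rewrite Forall_map. exact H.
Qed.

Lemma ForallOrdPairs_nth {X} (R : X -> X -> Prop) (Rsym : forall x y, R x y -> R y x) l d p q :
  ForallOrdPairs R l -> p <> q -> p < length l -> q < length l -> R (nth p l d) (nth q l d).
Proof.
  intros HR. revert p q. induction HR as [|x l H _ IH]; intros p q Hpq Hp Hq; cbn in *; [lia|].
  rewrite Forall_forall in H.
  destruct p as [|p], q as [|q]; [lia | | |].
  - apply H, nth_In. lia.
  - apply Rsym, H, nth_In. lia.
  - apply IH; lia.
Qed.

Lemma Forall2_nth_iff {X Y} (R : X -> Y -> Prop) l l' dx dy :
  Forall2 R l l' <->
  length l = length l' /\ forall k, k < length l -> R (nth k l dx) (nth k l' dy).
Proof.
  split.
  - induction 1 as [|x y l l' H _ [IH1 IH2]]; cbn; [split; [easy | lia]|].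
    split; [lia|]. intros [|k] Hk; [exact H | apply IH2; lia].
  - revert l'. induction l as [|x l IH]; intros [|y l'] [HL HN]; cbn in *; try discriminate; constructor.
    + apply (HN 0). lia.
    + apply IH. split; [lia|]. intros k Hk. apply (HN (S k)). lia.
Qed.

Lemma Forall2_map_r {X Y Z} (f : X -> Y) (R : Z -> Y -> Prop) l l' :
  Forall2 (fun z x => R z (f x)) l' l -> Forall2 R l' (map f l).
Proof. induction 1; cbn; constructor; auto. Qed.

Lemma choice_nat {X} (R : nat -> X -> Prop) :
  (forall i, exists x, R i x) -> exists f, forall i, R i (f i).
Proof.
  intros H. exists (fun i => proj1_sig (constructive_indefinite_description _ (H i))).
  intros i. apply proj2_sig.
Qed.

(** Only domains matter: each cell is asserted by some row and therefore holds 0, and [outside]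
    accepts any contents. So the implication reduces to the game. *)
Lemma design_models_unary A B n tau T :
  (forall x, x < n -> exists i, i < length A /\ tau i x = None) ->
  (forall j t x, T j = Some t -> In x t -> x < n) ->
  (forall F H, splitting A n tau F H -> wins A B n T F H) ->
  models 1 (lhs (map (row_assertion n tau) (seq 0 (length A))) A)
           (rhs (map (goal_assertion n T) (seq 0 (length B))) B).
Proof.
  intros Hcover HT Hgame eta rho hs Hl. rewrite sem_lhs in Hl. apply sem_rhs.
  destruct (choice_nat (fun i ps => i < length A ->
      Forall2 (fun a f => proj1_sig (rho a) f) (nth i A []) ps /\
      ForallOrdPairs apart ps /\ Forall (fun f => subheap f hs) ps /\
      sem 1 eta rho (row_assertion n tau i) (minus hs ps))) as [ps Hps].
  { intros i. destruct (lt_dec i (length A)) as [Hi|Hi].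
    - specialize (Hl i Hi). apply sem_star_vars in Hl as (ps & Hps). now exists ps.
    - exists []. easy. }
  set (piece := fun u : nat * nat => nth (snd u) (ps (fst u)) hs).
  assert (Hrho : forall u, is_piece A u -> proj1_sig (rho (piece_var A u)) (piece u)).
  { intros [i p] [Hi Hp]; cbn in *. destruct (Hps i Hi) as [H _].
    apply (Forall2_nth_iff _ _ _ 0 hs) in H as [_ H]. now apply H. }
  assert (Hlen : forall i, i < length A -> length (ps i) = length (nth i A [])).
  { intros i Hi. destruct (Hps i Hi) as [H _]. symmetry. eapply Forall2_length, H. }
  assert (Hsub : forall u, is_piece A u -> subheap (piece u) hs).
  { intros [i p] [Hi Hp]; cbn in *. destruct (Hps i Hi) as (_ & _ & H & _).
    rewrite Forall_forall in H. apply H, nth_In. now rewrite Hlen. }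
  assert (Hcell : forall i x, i < length A -> x < n -> tau i x = None ->
    hget (hs Fin.F1) (addr x) = Some 0%Z /\
    forall p, p < length (nth i A []) -> hget (piece (i, p) Fin.F1) (addr x) = None).
  { intros i x Hi Hx Ht. destruct (Hps i Hi) as (_ & _ & _ & H).
    apply sem_cells with (x := x) (k := Fin.F1) in H; [|lia|].
    - apply hget_minus in H as [H1 H2]. split; [exact H1|]. intros p Hp. apply H2, nth_In.
      cbn. now rewrite Hlen.
    - apply filter_In. split; [apply in_seq; lia | now rewrite Ht]. }
  assert (Hzero : forall x, x < n -> hget (hs Fin.F1) (addr x) = Some 0%Z).
  { intros x Hx. destruct (Hcover x Hx) as (i & Hi & Ht). now apply (Hcell i). }
  destruct (Hgame (fun u x => hget (piece u Fin.F1) (addr x) <> None)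
                  (fun x => hget (hs Fin.F1) (addr x) <> None)) as (j & sel & Hj & Hsel & Hdis & Hwin).
  - split; [|split; [|split]].
    + intros x Hx. now rewrite Hzero.
    + intros u x Hu. destruct (hget (piece u Fin.F1) (addr x)) as [v|] eqn:E; [|easy].
      intros _. now rewrite (Hsub u Hu _ _ _ E).
    + intros [i p] x [Hi Hp] Hf Hx Ht. apply Hf. now apply (Hcell i x Hi Hx Ht).
    + intros i p q x [Hi Hp] [_ Hq] Hfp Hfq. cbn in *. destruct (Nat.eq_dec p q) as [|Hpq]; [easy|].
      destruct (Hps i Hi) as (_ & H & _).
      assert (Hap : apart (piece (i, p)) (piece (i, q))).
      { apply ForallOrdPairs_nth; cbn; try assumption; rewrite ?Hlen; auto.
        intros f g Hfg k r. destruct (Hfg k r); auto. }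
      destruct (Hap Fin.F1 (addr x)); easy.
  - exists j. split; [exact Hj|]. apply sem_star_vars. exists (map piece sel).
    assert (Hall : Forall (is_piece A) sel).
    { unfold selection in Hsel. clear -Hsel. induction Hsel; constructor; tauto. }
    rewrite Forall_forall in Hall.
    split; [|split; [|split]].
    + apply Forall2_map_r. refine (Forall2_impl _ _ Hsel). intros b u [Hu <-]. auto.
    + apply ForallOrdPairs_map. clear -Hdis. induction Hdis as [|u l H _ IH]; constructor; [|exact IH].
      refine (Forall_impl _ _ H). intros v Hv k p. rewrite (fin1 k), <- (addr_pred p).
      specialize (Hv (Nat.pred (Pos.to_nat p))).
      destruct (hget (piece u Fin.F1) _), (hget (piece v Fin.F1) _); auto.
      exfalso. now apply Hv.
    + apply Forall_map, Forall_forall. intros u Hu. auto.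
    + assert (Hleft : forall x v, hget (hs Fin.F1) (addr x) = Some v ->
        (forall u, In u sel -> ~ hget (piece u Fin.F1) (addr x) <> None) ->
        forall k, hget (minus hs (map piece sel) k) (addr x) = Some v).
      { intros x v Hv Hu k. rewrite (fin1 k). apply hget_minus. split; [exact Hv|].
        intros f Hf. apply in_map_iff in Hf as (u & <- & Hin). specialize (Hu u Hin).
        destruct (hget (piece u Fin.F1) (addr x)); [exfalso; now apply Hu | easy]. }
      destruct Hwin as [(x & Hx & Hh & Hf)|(t & Ht & Hf)].
      * right. apply sem_outside; [lia|].
        destruct (hget (hs Fin.F1) (addr x)) as [v|] eqn:E; [|easy].
        exists x, v. split; [exact Hx|]. now apply Hleft.
      * left. rewrite Ht. apply sem_cells; [lia|]. intros x Hx. apply Hleft; [|auto].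
        apply Hzero. eapply HT; eauto.
Qed.

(** * The binary counterexample *)

Definition side (k : Fin.t 2) : bool := match k with Fin.F1 => true | Fin.FS _ => false end.

(* Addresses from [n] on encode pairs of pieces.  They carry different values in the two heaps,
   so no assertion can see them, and they make any two pieces from different rows overlap. *)
Definition owns (n : nat) (tau : nat -> nat -> option (nat * nat)) (s : bool)
    (u : nat * nat) (x : nat) : bool :=
  if x <? n then
    match tau (fst u) x with
    | Some (p, q) => (if s then p else q) =? snd u
    | None => false
    end
  else
    let '(a, b) := Cantor.of_nat (x - n) in
    (a =? Cantor.to_nat u) ||
    ((b =? Cantor.to_nat u) && negb (fst (Cantor.of_nat a) =? fst (Cantor.of_nat b))).

Definition shared (n : nat) (u v : nat * nat) : nat :=
  n + Cantor.to_nat (Cantor.to_nat u, Cantor.to_nat v).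

(** The case [u = v] makes a piece overlap itself, so that it cannot be selected twice. *)
Lemma owns_shared n tau s u v :
  owns n tau s u (shared n u v) = true /\
  (fst u <> fst v \/ u = v -> owns n tau s v (shared n u v) = true).
Proof.
  unfold owns, shared. destruct (Nat.ltb_spec (n + Cantor.to_nat (Cantor.to_nat u, Cantor.to_nat v)) n); [lia|].
  replace (n + Cantor.to_nat (Cantor.to_nat u, Cantor.to_nat v) - n)
    with (Cantor.to_nat (Cantor.to_nat u, Cantor.to_nat v)) by lia.
  rewrite Cantor.cancel_of_to. rewrite !Nat.eqb_refl. split; [reflexivity|].
  rewrite !Cantor.cancel_of_to. intros [Hne| ->].
  - apply Nat.eqb_neq in Hne. rewrite Hne. cbn. apply Bool.orb_true_r.
  - now rewrite Nat.eqb_refl.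
Qed.

(** Pieces of one row stay disjoint: an address coding two of them belongs only to the first, as the
    second clause of [owns] requires different rows. *)
Lemma owns_row_inj n tau s i p q x :
  owns n tau s (i, p) x = true -> owns n tau s (i, q) x = true -> p = q.
Proof.
  unfold owns; cbn [fst snd]. destruct (x <? n).
  - destruct (tau i x) as [[p' q']|]; [|discriminate].
    rewrite !Nat.eqb_eq. congruence.
  - destruct (Cantor.of_nat (x - n)) as [a b].
    assert (Hinj : forall c r, c = Cantor.to_nat (i, r) -> Cantor.of_nat c = (i, r))
      by (intros c r ->; apply Cantor.cancel_of_to).
    rewrite !Bool.orb_true_iff, !Bool.andb_true_iff, !Bool.negb_true_iff, !Nat.eqb_eq, !Nat.eqb_neq.
    intros [H1|[H1 D1]] [H2|[H2 D2]]; apply Hinj in H1, H2; rewrite H1 in H2 || (try rewrite H1, H2 in *);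
      cbn in *; congruence.
Qed.

Definition whole (n b : nat) (s : bool) : heap :=
  heap_of b (fun x => Some (if x <? n then 0%Z else if s then 1%Z else 2%Z)).

Definition part (n b : nat) tau (s : bool) (u : nat * nat) : heap :=
  heap_of b (fun x => if owns n tau s u x
                      then Some (if x <? n then 0%Z else if s then 1%Z else 2%Z) else None).

Lemma hget_part n b tau s u x v :
  hget (part n b tau s u) (addr x) = Some v <->
  owns n tau s u x = true /\ hget (whole n b s) (addr x) = Some v.
Proof.
  unfold part, whole. rewrite !hget_heap_of. destruct (x <? b), (owns n tau s u x); easy.
Qed.

Lemma part_subheap n b tau u : @subheap 2 (fun k => part n b tau (side k) u) (fun k => whole n b (side k)).
Proof. intros k p v. rewrite <- (addr_pred p), hget_part. easy. Qed.

(** Heaps are finite, so the shared addresses have to be cut off; there are finitely many pieces,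
    hence finitely many such addresses. *)
Lemma shared_bound A n :
  exists b, n <= b /\ forall u v, is_piece A u -> is_piece A v -> shared n u v < b.
Proof.
  set (ps := flat_map (fun i => map (pair i) (seq 0 (length (nth i A [])))) (seq 0 (length A))).
  assert (Hps : forall u, is_piece A u -> In u ps).
  { intros [i p] [Hi Hp]. apply in_flat_map. exists i. split; [apply in_seq; cbn in *; lia|].
    apply in_map, in_seq. cbn in *; lia. }
  set (l := map (fun w => shared n (fst w) (snd w)) (list_prod ps ps)).
  exists (n + S (list_max l)). split; [lia|]. intros u v Hu Hv.
  pose proof (proj1 (list_max_le l (list_max l)) (le_n _)) as H. rewrite Forall_forall in H.
  specialize (H (shared n u v)). cut (shared n u v <= list_max l); [lia|]. apply H.
  apply in_map_iff. exists (u, v). split; [reflexivity|]. apply in_prod; auto.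
Qed.

(** The valuation of the counterexample: the upward closure of the pieces carrying [c]. *)
Definition generated (A : list (list nat)) n b tau (c : nat) (fs : heapn 2) : Prop :=
  exists u, is_piece A u /\ piece_var A u = c /\ subheap (fun k => part n b tau (side k) u) fs.

Lemma generated_upclosed A n b tau c : upclosed (generated A n b tau c).
Proof.
  intros hs hs' Hext (u & Hu & Hc & Hs). exists u. split; [exact Hu|]. split; [exact Hc|].
  intros k p v E. now apply Hext, Hs.
Qed.

Lemma ForallOrdPairs_row {X} (R : X -> X -> Prop) (r : X -> nat) l d :
  (forall x y, R x y -> r x = r y) -> ForallOrdPairs R l ->
  exists i, (l = [] -> i = d) /\ forall x, In x l -> r x = i.
Proof.
  intros HR H. destruct H as [|x l H _]; [exists d; easy|].
  exists (r x). split; [easy|]. rewrite Forall_forall in H. intros y [<-|Hy]; [easy|].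
  symmetry. auto.
Qed.

Lemma ForallOrdPairs_Forall2 {X Y Z} (P : X -> Y -> Prop) (Q : Z -> X -> Prop) (R : Y -> Y -> Prop)
    (R' : X -> X -> Prop) ls us ps :
  (forall a b u v p q, Q a u -> Q b v -> P u p -> P v q -> R p q -> R' u v) ->
  Forall2 Q ls us -> Forall2 P us ps -> ForallOrdPairs R ps -> ForallOrdPairs R' us.
Proof.
  intros H HQ HP HR. revert ls us HQ HP. induction HR as [|p ps Hp _ IH]; intros ls us HQ HP.
  - inversion HP; subst. constructor.
  - inversion HP as [|u ? us' ? HPu HPus]; subst. inversion HQ as [|a ? ls' ? HQa HQls]; subst.
    constructor; [|eapply IH; eauto]. clear IH HP HQ. revert ls' HQls Hp.
    induction HPus as [|v q us ps Hv HP IH]; intros ls' HQls Hp; [constructor|].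
    inversion HQls as [|b ? ls ? HQb HQls']; subst. inversion Hp; subst.
    constructor; eauto.
Qed.

(** Pieces chosen for a disjunct must be distinct and from one row, as all other pairs overlap. By
    [hits], a requested cell is then missing from one remaining heap, while addresses that are not
    cells carry different values. *)
Lemma design_not_models_binary A B n tau T :
  1 <= length A -> (forall j t x, T j = Some t -> In x t -> x < n) -> hits A B tau T ->
  ~ models 2 (lhs (map (row_assertion n tau) (seq 0 (length A))) A)
             (rhs (map (goal_assertion n T) (seq 0 (length B))) B).
Proof.
  intros HA HT Hhit Hm. destruct (shared_bound A n) as (b & Hb & Hshared).
  set (rho := fun c => exist (@upclosed 2) _ (generated_upclosed A n b tau c) : IRel 2).
  set (hs := fun k => whole n b (side k)).
  specialize (Hm (fun _ => 0%Z) rho hs). rewrite sem_lhs, sem_rhs in Hm.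
  destruct Hm as (j & Hj & Hm).
  - intros i Hi. apply sem_star_vars.
    exists (map (fun p k => part n b tau (side k) (i, p)) (seq 0 (length (nth i A [])))).
    split; [|split; [|split]].
    + apply Forall2_map_r. apply (Forall2_nth_iff _ _ _ 0 0). rewrite length_seq. split; [easy|].
      intros p Hp. rewrite seq_nth by exact Hp. exists (i, p). repeat split; auto.
      now intros k q v.
    + apply ForallOrdPairs_map. generalize (seq_NoDup (length (nth i A [])) 0).
      rewrite NoDup_iff_ForallOrdPairs. induction 1 as [|p l H _ IH]; constructor; [|exact IH].
      refine (Forall_impl _ _ H). intros q Hpq k r. rewrite <- (addr_pred r).
      destruct (hget (part n b tau (side k) (i, p)) _) eqn:E1; [|now left].
      destruct (hget (part n b tau (side k) (i, q)) _) eqn:E2; [|now right].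
      apply hget_part in E1 as [E1 _], E2 as [E2 _].
      exfalso. apply Hpq. eapply owns_row_inj; eauto.
    + apply Forall_map, Forall_forall. intros p _. apply part_subheap.
    + apply sem_cells; [lia|]. intros x Hx k. apply filter_In in Hx as [Hx Ht]. apply in_seq in Hx.
      assert (Hxn : x <? n = true) by (apply Nat.ltb_lt; lia).
      apply hget_minus. split.
      * unfold hs, whole. rewrite hget_heap_of, Hxn. destruct (Nat.ltb_spec x b); [easy | lia].
      * intros f Hf. apply in_map_iff in Hf as (p & <- & _).
        destruct (hget (part n b tau (side k) (i, p)) (addr x)) as [v|] eqn:E; [|easy].
        apply hget_part in E as [E _]. unfold owns in E. rewrite Hxn in E. cbn in E.
        destruct (tau i x); [discriminate | discriminate].
  - apply sem_star_vars in Hm as (ps & HF & HP & HS & Hm).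
    assert (Hus : exists us, Forall2 (fun c u => is_piece A u /\ piece_var A u = c) (nth j B []) us /\
      Forall2 (fun u f => subheap (fun k => part n b tau (side k) u) f) us ps).
    { clear -HF. induction HF as [|c f l ps (u & Hu & Hc & Hs) _ (us & H1 & H2)].
      - exists []. split; constructor.
      - exists (u :: us). split; constructor; auto. }
    destruct Hus as (us & Hsel & Hus).
    assert (Hrow : ForallOrdPairs (fun u v => fst u = fst v /\ u <> v) us).
    { refine (ForallOrdPairs_Forall2 _ _ _ _ _ _ _ _ Hsel Hus HP).
      intros c d u v f g [Hu _] [Hv _] Hf Hg Ha.
      destruct (classic (fst u <> fst v \/ u = v)) as [Hc|Hc].
      - exfalso. pose proof (Hshared u v Hu Hv) as Hlt.
        destruct (owns_shared n tau true u v) as [H1 H2]. specialize (H2 Hc).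
        assert (Hw : exists w, hget (whole n b true) (addr (shared n u v)) = Some w).
        { unfold whole. rewrite hget_heap_of. destruct (Nat.ltb_spec (shared n u v) b); [eauto | lia]. }
        destruct Hw as [w Hw].
        pose proof (proj2 (hget_part n b tau _ _ _ _) (conj H1 Hw)) as E1.
        pose proof (proj2 (hget_part n b tau _ _ _ _) (conj H2 Hw)) as E2.
        apply (Hf Fin.F1) in E1. apply (Hg Fin.F1) in E2.
        destruct (Ha Fin.F1 (addr (shared n u v))); congruence.
      - apply not_or_and in Hc as [Hc1 Hc2]. split; [now apply NNPP | exact Hc2]. }
    assert (Hleft : forall k x v, hget (minus hs ps k) (addr x) = Some v ->
      forall u, In u us -> owns n tau (side k) u x = false).
    { intros k x v E u Hu. apply hget_minus in E as [E1 E2].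
      destruct (owns n tau (side k) u x) eqn:Eo; [|easy]. exfalso.
      apply (In_nth _ _ (0, 0)) in Hu as (m & Hm' & <-).
      apply (@Forall2_nth_iff _ (heapn 2) _ _ _ (0, 0) hs) in Hus as [HL HN].
      specialize (HN m Hm' k (addr x) v (proj2 (hget_part _ _ _ _ _ _ _) (conj Eo E1))).
      assert (E3 : hget (nth m ps hs k) (addr x) = None) by (apply E2, nth_In; lia).
      congruence. }
    destruct Hm as [Hm|Hm].
    + destruct (T j) as [t|] eqn:Et; [|easy]. rewrite sem_cells in Hm by lia.
      (* An empty selection determines no row; row 0 then serves. *)
      destruct (ForallOrdPairs_row _ fst us 0 (fun u v H => proj1 H) Hrow) as (i & Hi0 & Hi).
      assert (HiA : i < length A).
      { destruct us as [|u us]; [rewrite Hi0 by easy; lia|].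
        rewrite <- (Hi u) by now left. inversion Hsel; subst. now destruct H2 as [[? _] _]. }
      destruct (Hhit j t i (map snd us) Hj Et HiA) as (x & p & q & Hx & Ht & Hpq).
      { split.
        - apply NoDup_iff_ForallOrdPairs, ForallOrdPairs_map. clear -Hrow.
          induction Hrow as [|u l H _ IH]; constructor; [|exact IH].
          refine (Forall_impl _ _ H). intros v [H1 H2] H3. apply H2.
          destruct u, v; cbn in *; congruence.
        - apply Forall2_map_r. clear -Hsel Hi. unfold selection in Hsel.
          induction Hsel as [|c u l us [[H1 H2] H3] _ IH]; constructor.
          + rewrite <- (Hi u) by now left. now split.
          + apply IH. intros v Hv. apply Hi. now right. }
      assert (Hxn : x <? n = true) by (apply Nat.ltb_lt; eapply HT; eauto).
      assert (Hown : forall k : Fin.t 2, In (if side k then p else q) (map snd us) -> False).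
      { intros k Hin. apply in_map_iff in Hin as (u & Hu & Hin).
        specialize (Hleft k x _ (Hm x Hx k) u Hin). unfold owns in Hleft.
        rewrite Hxn, (Hi u Hin), Ht, Hu, Nat.eqb_refl in Hleft. discriminate. }
      destruct Hpq as [Hp|Hq]; [now apply (Hown Fin.F1) | now apply (Hown (Fin.FS Fin.F1))].
    + apply sem_outside in Hm; [|lia]. destruct Hm as (x & v & Hx & Hv).
      pose proof (proj1 (proj1 (hget_minus _ _ _ _ _) (Hv Fin.F1))) as E1.
      pose proof (proj1 (proj1 (hget_minus _ _ _ _ _) (Hv (Fin.FS Fin.F1)))) as E2.
      unfold hs, whole in E1, E2. rewrite hget_heap_of in E1, E2.
      destruct (x <? b); [|discriminate]. destruct (Nat.ltb_spec x n); [lia|].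
      cbn in E1, E2. congruence.
Qed.

Lemma design_sufficient A B n tau T :
  1 <= length A ->
  (forall x, x < n -> exists i, i < length A /\ tau i x = None) ->
  (forall j t x, T j = Some t -> In x t -> x < n) ->
  hits A B tau T ->
  (forall F H, splitting A n tau F H -> wins A B n T F H) ->
  separable A B.
Proof.
  intros HA Hcover HT Hhit Hgame.
  exists (map (row_assertion n tau) (seq 0 (length A))), (map (goal_assertion n T) (seq 0 (length B))).
  rewrite !length_map, !length_seq. repeat split.
  - apply Forall_map, Forall_forall. intros i _. apply cells_no_avar.
  - apply Forall_map, Forall_forall. intros j _. unfold goal_assertion.
    cbn [no_avar]. split; [destruct (T j); [apply cells_no_avar | easy]|].
    cbn. repeat split; trivial.
  - now apply design_models_unary.
  - now apply design_not_models_binary.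
Qed.

(** * Selecting pieces *)

Definition covers (A B : list (list nat)) (i j : nat) : Prop :=
  forall c, Omega B j c <= Pi A i c.

Lemma covers_PiGe A B i j :
  layout_ok A B -> j < length B -> (covers A B i j <-> PiGe A B i j).
Proof.
  intros [_ HV] Hj. split; [intros H c _; apply H|]. intros H c.
  destruct (in_dec Nat.eq_dec c (nth j B [])) as [Hc|Hc].
  - apply H, nodup_In, in_concat. destruct (HV j c Hj Hc) as (k & Hk & Hin).
    exists (nth k A []). split; [now apply nth_In | exact Hin].
  - unfold Omega. rewrite (proj1 (count_occ_not_In Nat.eq_dec _ _) Hc). lia.
Qed.

Lemma Omega_pos B j c : 0 < Omega B j c <-> In c (nth j B []).
Proof. symmetry. apply count_occ_In. Qed.

Definition row_var (A : list (list nat)) (i p : nat) : nat := nth p (nth i A []) 0.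

Definition row_vars (A : list (list nat)) (i : nat) (ps : list nat) : list nat :=
  map (row_var A i) ps.

Lemma length_filter_eqb (f : nat -> nat) ps c :
  length (filter (fun p => f p =? c) ps) = count_occ Nat.eq_dec (map f ps) c.
Proof.
  induction ps as [|p ps IH]; cbn; [easy|].
  destruct (Nat.eqb_spec (f p) c), (Nat.eq_dec (f p) c); cbn; congruence.
Qed.

Lemma row_vars_all A i : row_vars A i (seq 0 (length (nth i A []))) = nth i A [].
Proof.
  unfold row_vars, row_var. apply (nth_ext _ _ 0 0); rewrite length_map, length_seq; [easy|].
  intros k Hk. rewrite (nth_indep _ 0 (nth 0 (nth i A []) 0)) by (rewrite length_map, length_seq; lia).
  rewrite (map_nth (fun p => nth p (nth i A []) 0)), seq_nth by lia. easy.
Qed.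

Definition positions (A : list (list nat)) (i c : nat) : list nat :=
  filter (fun p => row_var A i p =? c) (seq 0 (length (nth i A []))).

Lemma in_positions A i c p :
  In p (positions A i c) <-> p < length (nth i A []) /\ row_var A i p = c.
Proof. unfold positions. rewrite filter_In, in_seq, Nat.eqb_eq. lia. Qed.

Lemma NoDup_positions A i c : NoDup (positions A i c).
Proof. apply NoDup_filter, seq_NoDup. Qed.

Lemma length_positions A i c : length (positions A i c) = Pi A i c.
Proof. unfold positions, Pi. rewrite length_filter_eqb. f_equal. apply row_vars_all. Qed.

Lemma row_selection_vars A B j i sel :
  row_selection A B j i sel ->
  row_vars A i sel = nth j B [] /\ forall p, In p sel -> p < length (nth i A []).
Proof.
  intros [_ H]. induction H as [|b p l sel [Hp Hb] _ [IH1 IH2]]; cbn; [easy|].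
  split; [unfold row_var; now rewrite Hb; f_equal|]. intros q [<-|Hq]; auto.
Qed.

Definition chosen A i sel c := filter (fun p => row_var A i p =? c) sel.

Lemma row_selection_chosen A B j i sel c :
  row_selection A B j i sel ->
  NoDup (chosen A i sel c) /\ incl (chosen A i sel c) (positions A i c) /\
  length (chosen A i sel c) = Omega B j c.
Proof.
  intros H. destruct (row_selection_vars _ _ _ _ _ H) as [H1 H2]. destruct H as [HN _].
  split; [now apply NoDup_filter|]. split.
  - intros p Hp. apply filter_In in Hp as [Hp Hc]. apply Nat.eqb_eq in Hc.
    apply in_positions. auto.
  - unfold chosen. rewrite length_filter_eqb. unfold Omega. now rewrite <- H1.
Qed.

Lemma row_selection_covers A B j i sel : row_selection A B j i sel -> covers A B i j.
Proof.
  intros H c. destruct (row_selection_chosen _ _ _ _ _ c H) as (H1 & H2 & H3).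
  rewrite <- H3, <- length_positions. now apply NoDup_incl_length.
Qed.

(** Pigeonhole: as many distinct pieces with variable [c] are chosen as the row has. *)
Lemma row_selection_full A B j i sel c p :
  row_selection A B j i sel -> Omega B j c = Pi A i c -> In p (positions A i c) -> In p sel.
Proof.
  intros H E Hp. destruct (row_selection_chosen _ _ _ _ _ c H) as (H1 & H2 & H3).
  apply NoDup_length_incl in H2; [|exact H1 | rewrite length_positions; lia].
  apply H2, filter_In in Hp. tauto.
Qed.

(** Greedy choice: a piece in [E] is taken whenever the variable has one, and otherwise a fresh
    position of row [i] is used up. In the game [E] means empty, so such pieces can be reused
    freely. *)
Lemma mixed_selection A i (E : nat * nat -> Prop) bs : forall ps,
  NoDup ps -> (forall p, In p ps -> is_piece A (i, p)) ->
  (forall c, In c bs -> (exists u, is_piece A u /\ piece_var A u = c /\ E u) \/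
     count_occ Nat.eq_dec bs c <= count_occ Nat.eq_dec (row_vars A i ps) c) ->
  exists sel, Forall2 (fun b u => is_piece A u /\ piece_var A u = b) bs sel /\
    (forall u, In u sel -> E u \/ (fst u = i /\ In (snd u) ps)) /\
    ForallOrdPairs (fun u v => E u \/ E v \/ (fst u = i /\ fst v = i /\ snd u <> snd v)) sel.
Proof.
  induction bs as [|b bs IH]; intros ps HN Hps Hc.
  - exists []. split; [constructor|]. split; [easy | constructor].
  - destruct (classic (exists u, is_piece A u /\ piece_var A u = b /\ E u)) as [(u & Hu & Hb & He)|He].
    + destruct (IH ps HN Hps) as (sel & H1 & H2 & H3).
      { intros c Hin. destruct (Hc c (or_intror Hin)) as [H|H]; [now left | right].
        cbn in H. destruct (Nat.eq_dec b c); lia. }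
      exists (u :: sel). split; [now constructor|]. split.
      * intros v [<-|Hv]; [now left | auto].
      * constructor; [|exact H3]. apply Forall_forall. intros v _. now left.
    + destruct (Hc b (or_introl eq_refl)) as [H|H]; [easy|]. cbn in H.
      destruct (Nat.eq_dec b b) as [_|]; [|easy].
      assert (Hin : In b (row_vars A i ps)) by (apply (count_occ_In Nat.eq_dec); lia).
      apply in_map_iff in Hin as (p & Hb & Hp). apply in_split in Hp as (ps1 & ps2 & ->).
      destruct (IH (ps1 ++ ps2)) as (sel & H1 & H2 & H3).
      * now apply NoDup_remove_1 in HN.
      * intros q Hq. apply Hps. apply in_app_iff in Hq. apply in_app_iff. cbn. tauto.
      * intros c Hcin. destruct (Hc c (or_intror Hcin)) as [H'|H']; [now left | right].
        unfold row_vars in *. rewrite map_app in *. cbn in H', H. rewrite count_occ_app in *.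
        cbn in H', H. rewrite Hb in *.
        destruct (Nat.eq_dec b c) as [->|]; [|lia]. destruct (Nat.eq_dec c c); [lia | easy].
      * exists ((i, p) :: sel). split; [|split].
        -- constructor; [split; [apply Hps, in_app_iff; cbn; tauto | exact Hb] | exact H1].
        -- intros v [<-|Hv]; [right; split; [easy | apply in_app_iff; cbn; tauto]|].
           destruct (H2 v Hv) as [|[? Hs]]; [now left | right; split; [easy|]].
           apply in_app_iff in Hs. apply in_app_iff. cbn. tauto.
        -- constructor; [|exact H3]. apply Forall_forall. intros v Hv.
           destruct (H2 v Hv) as [|[? Hs]]; [tauto|]. right. right. split; [easy|]. split; [easy|].
           intros E'. apply NoDup_remove_2 in HN. apply HN. cbn in E'. now rewrite E'.
Qed.

Lemma game_selection A B n tau F H j i ps :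
  splitting A n tau F H -> NoDup ps -> (forall p, In p ps -> is_piece A (i, p)) ->
  (forall c, In c (nth j B []) ->
    (exists u, is_piece A u /\ piece_var A u = c /\ forall x, ~ F u x) \/
    Omega B j c <= count_occ Nat.eq_dec (row_vars A i ps) c) ->
  exists sel, selection A B j sel /\
    ForallOrdPairs (fun u v => forall x, F u x -> F v x -> False) sel /\
    forall u x, In u sel -> F u x -> fst u = i /\ In (snd u) ps.
Proof.
  intros (_ & _ & _ & Hdis) HN Hps Hc.
  destruct (mixed_selection A i (fun u => forall x, ~ F u x) (nth j B []) ps HN Hps Hc)
    as (sel & H1 & H2 & H3).
  exists sel. split; [exact H1|]. split.
  - assert (Hall : Forall (is_piece A) sel)
      by (clear -H1; induction H1; constructor; tauto).
    clear -H3 Hall Hdis. induction H3 as [|u sel Hu _ IH]; constructor.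
    + inversion Hall as [|? ? Pu Ps]; subst. rewrite Forall_forall in *. intros v Hv x Fu Fv.
      destruct (Hu v Hv) as [H|[H|(E1 & E2 & E3)]]; [exact (H x Fu) | exact (H x Fv)|].
      apply E3. specialize (Ps v Hv). destruct u as [k p], v as [k' q]; cbn in *; subst.
      eapply Hdis; eauto.
    + apply IH. now inversion Hall.
  - intros u x Hu Fu. destruct (H2 u Hu) as [He|]; [exfalso; exact (He x Fu) | easy].
Qed.

Definition clean (A : list (list nat)) (i : nat) (dirty : list nat) : list nat :=
  filter (fun p => negb (existsb (Nat.eqb p) dirty)) (seq 0 (length (nth i A []))).

Lemma in_clean A i dirty p :
  In p (clean A i dirty) <-> p < length (nth i A []) /\ ~ In p dirty.
Proof.
  unfold clean. rewrite filter_In, in_seq, Bool.negb_true_iff, <- Bool.not_true_iff_false, existsb_exists.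
  split.
  - intros [H1 H2]. split; [lia|]. intros H. apply H2. exists p. now rewrite Nat.eqb_refl.
  - intros [H1 H2]. split; [lia|]. intros (q & Hq & E). apply Nat.eqb_eq in E. now subst.
Qed.

Lemma NoDup_clean A i dirty : NoDup (clean A i dirty).
Proof. apply NoDup_filter, seq_NoDup. Qed.

Lemma clean_piece A i dirty : i < length A -> forall p, In p (clean A i dirty) -> is_piece A (i, p).
Proof. intros Hi p Hp. apply in_clean in Hp. now split. Qed.

Lemma clean_count A i dirty c :
  Pi A i c <= count_occ Nat.eq_dec (row_vars A i (clean A i dirty)) c +
              count_occ Nat.eq_dec (row_vars A i dirty) c.
Proof.
  unfold row_vars. rewrite <- !length_filter_eqb, <- length_app, <- length_positions.
  apply NoDup_incl_length; [apply NoDup_positions|]. intros p Hp.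
  apply in_positions in Hp as [H1 H2]. apply in_app_iff. rewrite !filter_In, in_clean, Nat.eqb_eq.
  destruct (in_dec Nat.eq_dec p dirty); tauto.
Qed.

Lemma clean_count_length A i dirty c :
  Pi A i c <= count_occ Nat.eq_dec (row_vars A i (clean A i dirty)) c + length dirty.
Proof.
  pose proof (clean_count A i dirty c).
  pose proof (count_occ_bound Nat.eq_dec c (row_vars A i dirty)) as H1.
  unfold row_vars in H1 at 2. rewrite length_map in H1. lia.
Qed.

Lemma argmin (f : nat -> nat) l : l <> [] -> exists a, In a l /\ forall c, In c l -> f a <= f c.
Proof.
  induction l as [|b l IH]; [easy|]. intros _. destruct l as [|b' l].
  - exists b. split; [now left|]. intros c [<-|[]]. lia.
  - destruct IH as (a & Ha & Hm); [easy|]. destruct (le_lt_dec (f b) (f a)).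
    + exists b. split; [now left|]. intros c [<-|Hc]; [lia|]. specialize (Hm c Hc). lia.
    + exists a. split; [now right|]. intros c [<-|Hc]; [lia | auto].
Qed.

(** * A row without a common full variable *)

Definition touched (A B : list (list nat)) (k : nat) (e : list (nat * nat)) (l : nat) : Prop :=
  nth l B [] <> [] /\
  forall sel, row_selection A B l k sel -> exists p q, In (p, q) e /\ (In p sel \/ In q sel).

(* Row [k] contributes one cell per pair in [e]; the cell lies in the first piece of the pair in
   one heap and in the second piece in the other.  Every other row contributes one cell per piece. *)
Lemma row_design A B k e :
  2 <= length A -> k < length A ->
  (forall dirty, length dirty <= length e -> exists l, l < length B /\ touched A B k e l /\
     forall c, In c (nth l B []) ->
       Omega B l c <= count_occ Nat.eq_dec (row_vars A k (clean A k dirty)) c) ->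
  separable A B.
Proof.
  intros HA Hk Hl. set (t := length e). set (w := list_max (map (@length nat) A)).
  assert (Hw : forall i p, i < length A -> p < length (nth i A []) -> p < w).
  { intros i p Hi Hp. pose proof (proj1 (list_max_le (map (@length nat) A) w) (le_n _)) as H.
    rewrite Forall_forall in H. specialize (H (length (nth i A []))).
    enough (length (nth i A []) <= w) by lia. apply H, in_map, nth_In, Hi. }
  (* Cells below [t] come from the pairs in [e]; cell [t + p] is assigned to piece [p] of every row
     other than [k]. *)
  set (tau := fun i x => if i =? k then (if x <? t then Some (nth x e (0, 0)) else None)
                         else if x <? t then None else Some (x - t, x - t)).
  set (T := fun l => if excluded_middle_informative (touched A B k e l)
                     then Some (seq 0 (t + w)) else None).
  apply (design_sufficient A B (t + w) tau T).
  - lia.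
  (* Cells from [e] are asserted by a second row, the remaining ones by row [k]. *)
  - intros x Hx. destruct (Nat.ltb_spec x t) as [L|L].
    + exists (if k =? 0 then 1 else 0). unfold tau.
      apply Nat.ltb_lt in L. rewrite L.
      destruct (Nat.eqb_spec k 0) as [->|Hk0]; cbn; [now split|].
      split; [lia|]. destruct k; easy.
    + exists k. split; [exact Hk|]. unfold tau. rewrite Nat.eqb_refl.
      apply Nat.ltb_ge in L. now rewrite L.
  - unfold T. intros j s x. destruct (excluded_middle_informative _); [|easy].
    intros [= <-] Hx. apply in_seq in Hx. lia.
  - intros j s i sel Hj. unfold T. destruct (excluded_middle_informative _) as [[Hne Ht]|]; [|easy].
    intros [= <-] Hi Hsel. destruct (Nat.eq_dec i k) as [->|Hik].
    + destruct (Ht sel Hsel) as (p & q & He & Hpq).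
      apply (In_nth _ _ (0, 0)) in He as (x & Hx & E). exists x, p, q.
      split; [apply in_seq; unfold t; lia|]. split; [|exact Hpq].
      unfold tau. rewrite Nat.eqb_refl. apply Nat.ltb_lt in Hx. unfold t. now rewrite Hx, E.
    + destruct (row_selection_vars _ _ _ _ _ Hsel) as [H1 H2].
      destruct sel as [|p sel]; [now cbn in H1; rewrite <- H1 in Hne|].
      specialize (H2 p (or_introl eq_refl)). specialize (Hw i p Hi H2).
      exists (t + p), p, p. split; [apply in_seq; lia|]. split; [|cbn; tauto].
      unfold tau. apply Nat.eqb_neq in Hik. rewrite Hik.
      destruct (Nat.ltb_spec (t + p) t); [lia|]. now replace (t + p - t) with p by lia.
  - intros F H HS. pose proof HS as (_ & _ & Htau & Hdis).
    destruct (choice_nat (fun x p => (exists p', is_piece A (k, p') /\ F (k, p') x) ->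
        is_piece A (k, p) /\ F (k, p) x)) as [owner Howner].
    { intros x. destruct (classic (exists p', is_piece A (k, p') /\ F (k, p') x)) as [(p & Hp)|Hn];
        [now exists p | now exists 0]. }
    destruct (Hl (map owner (seq 0 t))) as (l & HlB & Ht & Hc).
    { rewrite length_map, length_seq. apply le_n. }
    destruct (game_selection A B _ tau F H l k (clean A k (map owner (seq 0 t))) HS) as (sel & H1 & H2 & H3).
    + apply NoDup_clean.
    + now apply clean_piece.
    + auto.
    + exists l, sel. split; [exact HlB|]. split; [exact H1|]. split; [exact H2|]. right.
      exists (seq 0 (t + w)). unfold T. destruct (excluded_middle_informative _); [|easy].
      split; [easy|]. intros x [i p] Hx Hu HF. apply in_seq in Hx.
      destruct (H3 _ _ Hu HF) as [Hi Hp]. cbn in Hi, Hp. subst i.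
      pose proof (clean_piece A k _ Hk p Hp) as Hpiece. apply in_clean in Hp as [_ Hp].
      destruct (Nat.ltb_spec x t) as [L|L].
      * apply Hp, in_map_iff. exists x. split; [|apply in_seq; lia].
        destruct (Howner x) as [Ho1 Ho2]; [now exists p|]. eapply Hdis; eauto.
      * apply (Htau _ x Hpiece HF); [lia|]. unfold tau. cbn [fst]. rewrite Nat.eqb_refl.
        apply Nat.ltb_ge in L. now rewrite L.
Qed.

(** Let [a] be the variable of [b_l] with the least slack [d] in row [k], and pair one piece of [a]
    with [d] others. A selection omits only [d] pieces of [a], so it meets this star; in one heap
    the [d] cells spoil at most [d] pieces, which the slack of every variable absorbs. *)
Lemma no_full_var A B k l :
  2 <= length A -> k < length A -> l < length B -> nth l B [] <> [] ->
  (forall c, In c (nth l B []) -> Omega B l c < Pi A k c) ->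
  separable A B.
Proof.
  intros HA Hk Hl Hne Hlt.
  destruct (argmin (fun c => Pi A k c - Omega B l c) _ Hne) as (a & Ha & Hmin).
  set (d := Pi A k a - Omega B l a) in *.
  pose proof (Hlt a Ha) as Hlta. pose proof (proj2 (Omega_pos B l a) Ha) as Hpos.
  destruct (firstn (S d) (positions A k a)) as [|q rest] eqn:E.
  { apply (f_equal (@length nat)) in E. rewrite length_firstn, length_positions in E. cbn [length] in E. lia. }
  assert (Hlen : length rest = d).
  { apply (f_equal (@length nat)) in E. rewrite length_firstn, length_positions in E. cbn [length] in E. lia. }
  assert (Hstar : NoDup (q :: rest) /\ incl (q :: rest) (positions A k a)).
  { pose proof (NoDup_positions A k a) as HN. rewrite <- (firstn_skipn (S d)), E in HN.
    split; [now apply NoDup_app_remove_r in HN|].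
    intros p Hp. rewrite <- (firstn_skipn (S d)), E. apply in_app_iff. now left. }
  destruct Hstar as [HN Hincl].
  apply (row_design A B k (map (pair q) rest) HA Hk). rewrite length_map, Hlen.
  intros dirty Hd. exists l. split; [exact Hl|]. split.
  - split; [exact Hne|]. intros sel Hsel.
    destruct (row_selection_chosen _ _ _ _ _ a Hsel) as (C1 & C2 & C3).
    destruct (classic (exists p, In p sel /\ In p (q :: rest))) as [(p & Hp & Hin)|Hno].
    + destruct Hin as [<-|Hin].
      * destruct rest as [|r rest]; [cbn in Hlen; lia|]. exists q, r.
        split; [now left | now left].
      * exists q, p. split; [now apply in_map | now right].
    + exfalso.
      assert (Hle : length (chosen A k sel a ++ q :: rest) <= length (positions A k a)).
      { apply NoDup_incl_length.
        - apply NoDup_app; try assumption. intros p Hp Hin. apply Hno. exists p.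
          apply filter_In in Hp. tauto.
        - now apply incl_app. }
      rewrite length_app, C3, length_positions in Hle. cbn in Hle. lia.
  - intros c Hc. pose proof (clean_count_length A k dirty c). specialize (Hmin c Hc).
    specialize (Hlt c Hc). cbn in Hmin. lia.
Qed.

Definition fills (A B : list (list nat)) (k l c : nat) : Prop :=
  nth l B [] <> [] /\ covers A B k l /\ 0 < Pi A k c /\ Omega B l c = Pi A k c.

(** Let [d] be full in as many disjuncts as possible, [l'] a covered disjunct where it is not full,
    and [e] full in [l']. One cell, in a piece of [d] in one heap and of [e] in the other, is met by
    every selection from row [k] for these disjuncts. In the unary game it spoils a single piece,
    whose variable cannot be full in all of them. *)
Lemma no_common_full_var A B k l :
  2 <= length A -> k < length A -> l < length B -> nth l B [] <> [] -> covers A B k l ->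
  (forall c, 0 < Pi A k c ->
     exists l', l' < length B /\ nth l' B [] <> [] /\ covers A B k l' /\ Omega B l' c <> Pi A k c) ->
  separable A B.
Proof.
  intros HA Hk Hl Hne Hcov Hno. apply NNPP. intros Hcon.
  assert (Hfull : forall l', l' < length B -> nth l' B [] <> [] -> covers A B k l' ->
    exists c, fills A B k l' c).
  { intros l' Hl' Hne' Hcov'. apply NNPP. intros Hn. apply Hcon.
    apply (no_full_var A B k l' HA Hk Hl' Hne'). intros c Hc.
    apply Omega_pos in Hc. specialize (Hcov' c) as Hle.
    destruct (Nat.eq_dec (Omega B l' c) (Pi A k c)) as [E|]; [|lia].
    exfalso. apply Hn. exists c. repeat split; try assumption; lia. }
  set (fl := fun c => filter (fun j => if excluded_middle_informative (fills A B k j c)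
                                       then true else false) (seq 0 (length B))).
  assert (Hfl : forall j c, In j (fl c) <-> j < length B /\ fills A B k j c).
  { intros j c. unfold fl. rewrite filter_In, in_seq.
    destruct (excluded_middle_informative _); split; intros [? ?]; split; try easy; lia. }
  assert (Hflb : forall c, length (fl c) <= length B).
  { intros c. rewrite <- (length_seq (length B) 0) at 1. apply NoDup_incl_length.
    - apply NoDup_filter, seq_NoDup.
    - apply incl_filter. }
  assert (HAk : nth k A [] <> []).
  { destruct (Hfull l Hl Hne Hcov) as (c & _ & _ & Hc & _). unfold Pi in Hc.
    intros E. rewrite E in Hc. cbn in Hc. lia. }
  (* Minimizing the complement maximizes the number of disjuncts in which [d] is full. *)
  destruct (argmin (fun c => length B - length (fl c)) _ HAk) as (d & Hd & Hmax).
  assert (Hdpos : 0 < Pi A k d) by now apply count_occ_In.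
  destruct (Hno d Hdpos) as (l' & Hl' & Hne' & Hcov' & Hnd).
  destruct (Hfull l' Hl' Hne' Hcov') as (e & He).
  assert (Hpos : forall c, 0 < Pi A k c -> exists p, In p (positions A k c)).
  { intros c Hc. rewrite <- length_positions in Hc. destruct (positions A k c) as [|p ps]; [cbn in Hc; lia|].
    exists p. now left. }
  destruct (Hpos d Hdpos) as [pd Hpd]. destruct (Hpos e) as [pe Hpe]; [apply He|].
  apply Hcon. apply (row_design A B k [(pd, pe)] HA Hk). cbn [length].
  assert (Htouch : forall j, fills A B k j d \/ j = l' -> touched A B k [(pd, pe)] j).
  { intros j Hj. split; [destruct Hj as [[? _]| ->]; assumption|]. intros sel Hsel.
    exists pd, pe. split; [now left|]. destruct Hj as [(_ & _ & _ & Hj)| ->].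
    - left. eapply row_selection_full; eauto.
    - right. eapply row_selection_full; eauto. apply He. }
  intros dirty Hdirty.
  (* A variable full in [l'] and wherever [d] is would contradict the maximality of [d]. *)
  assert (Havoid : forall r, exists j, j < length B /\ (fills A B k j d \/ j = l') /\
      covers A B k j /\ (0 < Pi A k r -> Omega B j r < Pi A k r)).
  { intros r. apply NNPP. intros Hn.
    assert (Hall : forall j, j < length B -> fills A B k j d \/ j = l' -> fills A B k j r).
    { intros j Hj Hjd. assert (Hcj : nth j B [] <> [] /\ covers A B k j)
        by (destruct Hjd as [(? & ? & _)| ->]; now split).
      destruct Hcj as [Hnj Hcj]. pose proof (Hcj r) as Hle.
      destruct (classic (0 < Pi A k r /\ Omega B j r = Pi A k r)) as [[H1 H2]|Hx].
      - now repeat split.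
      - exfalso. apply Hn. exists j. repeat split; try assumption. lia. }
    assert (Hr : In r (nth k A [])).
    { apply (count_occ_In Nat.eq_dec). destruct (Hall l' Hl' (or_intror eq_refl)) as (_ & _ & H & _). exact H. }
    specialize (Hmax r Hr). cbn in Hmax.
    assert (Hlt : length (l' :: fl d) <= length (fl r)).
    { apply NoDup_incl_length.
      - constructor; [|apply NoDup_filter, seq_NoDup]. rewrite Hfl. intros [_ (_ & _ & _ & H)]. easy.
      - intros j [<-|Hj]; apply Hfl; [split; [easy | apply Hall; auto]|].
        apply Hfl in Hj as [Hj1 Hj2]. split; [easy | apply Hall; auto]. }
    cbn in Hlt. specialize (Hflb r) as Hb. lia. }
  (* If no piece is dirty, the default position merely names a variable that is avoided
     needlessly. *)
  destruct (Havoid (row_var A k (nth 0 dirty 0))) as (j & Hj & Hjd & Hcj & Hlt).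
  exists j. split; [exact Hj|]. split; [now apply Htouch|]. intros c Hc.
  pose proof (clean_count A k dirty c) as Hcount. specialize (Hcj c) as Hle.
  apply Omega_pos in Hc.
  destruct dirty as [|r [|r' dirty]]; cbn [length] in Hdirty; [cbn in Hcount; lia | | lia].
  cbn [row_vars map nth count_occ] in *. destruct (Nat.eq_dec (row_var A k r) c) as [<-|]; cbn in Hcount; lia.
Qed.

(** * One cell per row *)

(* Row [i] contributes a cell when [pk i = Some p]; the cell then lies in piece [(i, p)]. *)
Definition cell_tau (pk : nat -> option nat) (i x : nat) : option (nat * nat) :=
  if i =? x then match pk i with Some p => Some (p, p) | None => None end else None.

Definition useful (A B : list (list nat)) (pk : nat -> option nat) (j : nat) : Prop :=
  nth j B [] <> [] /\ forall k, k < length A -> covers A B k j -> pk k <> None.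

(** Only cells of covering rows are requested, since a selection from a single row exists only if
    that row covers the disjunct. *)
Definition cell_goal (A B : list (list nat)) (pk : nat -> option nat) (j : nat) : option (list nat) :=
  if excluded_middle_informative (useful A B pk j)
  then Some (filter (fun k => if excluded_middle_informative (covers A B k j) then true else false)
                    (seq 0 (length A)))
  else None.

(** With two rows, a cell hidden by one is asserted by another. Fullness forces every selection from
    row [k] for a nonempty disjunct to contain the piece with its cell. *)
Definition admissible (A B : list (list nat)) (pk : nat -> option nat) : Prop :=
  (2 <= length A \/ forall k, pk k = None) /\
  forall k p, k < length A -> pk k = Some p -> p < length (nth k A []) /\
    forall l, l < length B -> nth l B [] <> [] -> covers A B k l ->
      Omega B l (row_var A k p) = Pi A k (row_var A k p).

Definition survives (A B : list (list nat)) (pk : nat -> option nat)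
    (F : nat * nat -> nat -> Prop) (H : nat -> Prop) : Prop :=
  splitting A (length A) (cell_tau pk) F H /\ ~ wins A B (length A) (cell_goal A B pk) F H.

(** If the adversary always lost, the design would separate. A survivor is the hypothetical
    splitting to be refuted. *)
Lemma survivor_exists A B pk :
  1 <= length A -> admissible A B pk -> ~ separable A B -> exists F H, survives A B pk F H.
Proof.
  intros HA [Hcov Hfull] Hcon. apply NNPP. intros Hn. apply Hcon.
  apply (design_sufficient A B (length A) (cell_tau pk) (cell_goal A B pk)).
  - exact HA.
  - intros x Hx. unfold cell_tau. destruct Hcov as [H2|H0].
    + exists (if x =? 0 then 1 else 0).
      destruct (Nat.eqb_spec x 0) as [->|Hx0]; [now split|].
      split; [lia|]. destruct x; easy.
    + exists x. rewrite H0. split; [exact Hx|]. now destruct (x =? x).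
  - intros j t x. unfold cell_goal. destruct (excluded_middle_informative _); [|easy].
    intros [= <-] Hx. apply filter_In in Hx as [Hx _]. apply in_seq in Hx. lia.
  - intros j t i sel Hj. unfold cell_goal. destruct (excluded_middle_informative _) as [[Hne Hu]|]; [|easy].
    intros [= <-] Hi Hsel. pose proof (row_selection_covers _ _ _ _ _ Hsel) as Hc.
    specialize (Hu i Hi Hc). destruct (pk i) as [p|] eqn:E; [|easy].
    destruct (Hfull i p Hi E) as [Hp Hf]. exists i, p, p. split; [|split].
    + apply filter_In. split; [apply in_seq; lia|]. now destruct (excluded_middle_informative _).
    + unfold cell_tau. now rewrite Nat.eqb_refl, E.
    + left. eapply row_selection_full; [exact Hsel | now apply Hf|]. now apply in_positions.
  - intros F H HS. apply NNPP. intros Hw. apply Hn. exists F, H. now split.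
Qed.

(** Row [i] asserts every cell but its own, so its pieces can contain no other. *)
Lemma survivor_cell A B pk F H i p x :
  survives A B pk F H -> is_piece A (i, p) -> F (i, p) x -> x < length A -> x = i /\ pk i <> None.
Proof.
  intros [(_ & _ & Ht & _) _] Hp HF Hx. specialize (Ht _ _ Hp HF Hx). unfold cell_tau in Ht.
  cbn [fst] in Ht. destruct (Nat.eqb_spec i x) as [->|]; [|easy]. split; [easy|].
  now destruct (pk x).
Qed.

Lemma selection_piece A B j sel u : selection A B j sel -> In u sel -> is_piece A u.
Proof.
  intros H Hu. unfold selection in H. induction H as [|b v l sel [Hv _] _ IH]; [easy|].
  destruct Hu as [<-|Hu]; auto.
Qed.

Lemma survivor_outside A B pk F H j sel x :
  survives A B pk F H -> j < length B -> selection A B j sel ->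
  ForallOrdPairs (fun u v => forall x, F u x -> F v x -> False) sel ->
  length A <= x -> H x -> exists u, In u sel /\ F u x.
Proof.
  intros [_ Hw] Hj Hsel Hdis Hx HH. apply NNPP. intros Hn. apply Hw. exists j, sel.
  repeat split; try assumption. left. exists x. repeat split; try assumption.
  intros u Hu HF. apply Hn. now exists u.
Qed.

(** Otherwise all requested cells would remain. A cell in a selected piece belongs to the row of
    that piece, and only cells of covering rows are requested. *)
Lemma survivor_useful A B pk F H j sel :
  survives A B pk F H -> j < length B -> selection A B j sel ->
  ForallOrdPairs (fun u v => forall x, F u x -> F v x -> False) sel ->
  useful A B pk j -> exists i p, is_piece A (i, p) /\ In (i, p) sel /\ F (i, p) i /\ covers A B i j.
Proof.
  intros HS Hj Hsel Hdis Hu. apply NNPP. intros Hn. apply (proj2 HS). exists j, sel.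
  repeat split; try assumption. right. unfold cell_goal.
  destruct (excluded_middle_informative _); [|easy]. eexists. split; [reflexivity|].
  intros x [i p] Hx Hin HF. apply filter_In in Hx as [Hx Hc]. apply in_seq in Hx.
  destruct (excluded_middle_informative _) as [Hcov|]; [|easy].
  pose proof (selection_piece _ _ _ _ _ Hsel Hin) as Hp.
  destruct (survivor_cell _ _ _ _ _ _ _ _ HS Hp HF) as [-> _]; [lia|].
  apply Hn. now exists i, p.
Qed.

(** * Unbalanced variables and empty pieces *)

Lemma unbalanced_witness A B c :
  layout_ok A B -> ~ balanced A B c ->
  exists k l, k < length A /\ l < length B /\ covers A B k l /\ Omega B l c < Pi A k c.
Proof.
  intros HL Hb. apply NNPP. intros Hn. apply Hb. intros k l [Hk Hl] Hge.
  apply (covers_PiGe A B k l HL Hl) in Hge. specialize (Hge c) as Hle.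
  destruct (Nat.eq_dec (Pi A k c) (Omega B l c)) as [|Hne]; [easy|].
  exfalso. apply Hn. exists k, l. repeat split; try assumption. lia.
Qed.

(** Two ways to keep a cell out of a piece that some selection omits: every nonempty disjunct can be
    won by its cells, or no row hides a cell. *)
Definition good (A B : list (list nat)) (pk : nat -> option nat) : Prop :=
  (forall l, l < length B -> nth l B [] <> [] -> useful A B pk l) \/ forall k, pk k = None.

(* [b_l] can be selected from row [k] without the given [c]-piece, so what that piece contains
   would be left over. *)
Lemma unbalanced_piece_empty A B pk F H k l c p x :
  survives A B pk F H -> good A B pk -> k < length A -> l < length B -> nth l B [] <> [] ->
  covers A B k l -> Omega B l c < Pi A k c -> In p (positions A k c) -> ~ F (k, p) x.
Proof.
  intros HS Hg Hk Hl Hne Hcov Hlt Hp HF. apply in_positions in Hp as [Hp Hc].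
  assert (Hpiece : is_piece A (k, p)) by now split.
  pose proof HS as [Hsp _]. pose proof Hsp as (_ & Hsub & _ & Hdis).
  destruct (game_selection A B _ _ F H l k (clean A k [p]) Hsp) as (sel & H1 & H2 & H3).
  - apply NoDup_clean.
  - now apply clean_piece.
  - intros d _. right. pose proof (clean_count A k [p] d) as Hcc. specialize (Hcov d).
    cbn in Hcc. destruct (Nat.eq_dec (row_var A k p) d); [|lia]. subst d. rewrite Hc in *. lia.
  - assert (Hnot : forall u y, In u sel -> F u y -> F (k, p) y -> False).
    { intros [i q] y Hu Fu Fp. destruct (H3 _ _ Hu Fu) as [Hi Hq]. cbn in Hi, Hq. subst i.
      pose proof (clean_piece A k [p] Hk q Hq) as Hqp. apply in_clean in Hq as [_ Hq].
      apply Hq. left. eapply Hdis; eauto. }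
    destruct (le_lt_dec (length A) x) as [L|L].
    + destruct (survivor_outside _ _ _ _ _ _ _ x HS Hl H1 H2 L (Hsub _ _ Hpiece HF)) as (u & Hu & Fu).
      eauto.
    (* The cell is that of row [k]. A useful disjunct needs a selected piece holding the cell of its
       own row, and nonempty selected pieces lie in row [k], so two pieces would share this cell. *)
    + destruct (survivor_cell _ _ _ _ _ _ _ _ HS Hpiece HF L) as [-> Hpk].
      destruct Hg as [Hg|Hg]; [|now rewrite Hg in Hpk].
      destruct (survivor_useful _ _ _ _ _ _ _ HS Hl H1 H2 (Hg l Hl Hne)) as (i & q & _ & Hin & Fq & _).
      destruct (H3 _ _ Hin Fq) as [Hi _]. cbn in Hi. subst i. eauto.
Qed.

Lemma unbalanced_empty_piece A B pk F H c :
  layout_ok A B -> survives A B pk F H -> good A B pk ->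
  (forall l, l < length B -> nth l B [] <> []) -> ~ balanced A B c ->
  exists u, is_piece A u /\ piece_var A u = c /\ forall x, ~ F u x.
Proof.
  intros HL HS Hg Hne Hb. destruct (unbalanced_witness A B c HL Hb) as (k & l & Hk & Hl & Hcov & Hlt).
  destruct (positions A k c) as [|p ps] eqn:E.
  { apply (f_equal (@length nat)) in E. rewrite length_positions in E. cbn [length] in E. lia. }
  assert (Hp : In p (positions A k c)) by (rewrite E; now left).
  exists (k, p). pose proof Hp as Hp'. apply in_positions in Hp' as [H1 H2].
  split; [now split|]. split; [exact H2|]. intros x.
  eapply unbalanced_piece_empty; eauto.
Qed.

Lemma layout_var A B j b :
  layout_ok A B -> j < length B -> In b (nth j B []) ->
  In b (Vset A) /\ exists u, is_piece A u /\ piece_var A u = b.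
Proof.
  intros [_ HV] Hj Hb. destruct (HV j b Hj Hb) as (i & Hi & Hin). split.
  - apply nodup_In, in_concat. exists (nth i A []). split; [now apply nth_In | exact Hin].
  - apply (In_nth _ _ 0) in Hin as (p & Hp & E). now exists (i, p).
Qed.

(** A selection of empty pieces leaves every outside address in place. A disjunct violating (S2) has
    only unbalanced variables and so admits one; for an empty disjunct the empty selection does. *)
Lemma no_outside A B pk F H :
  layout_ok A B -> survives A B pk F H -> good A B pk -> ~ S2 A B ->
  forall x, length A <= x -> ~ H x.
Proof.
  intros HL HS Hg HS2 x Hx HH.
  destruct (classic (exists l, l < length B /\ nth l B [] = [])) as [(l & Hl & El)|Hno].
  - destruct (survivor_outside A B pk F H l [] x HS Hl) as (u & [] & _); try assumption.
    + unfold selection. rewrite El. constructor.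
    + constructor.
  - apply HS2. intros j Hj. apply NNPP. intros Hn.
    destruct (game_selection A B _ _ F H j 0 [] (proj1 HS)) as (sel & H1 & H2 & H3).
    + constructor.
    + easy.
    + intros c Hc. left. apply (unbalanced_empty_piece A B pk F H c HL HS Hg).
      * intros l Hl El. apply Hno. now exists l.
      * intros Hb. apply Hn. exists c. split; [|split; [now apply Omega_pos | exact Hb]].
        eapply layout_var; eauto.
    + destruct (survivor_outside _ _ _ _ _ _ _ x HS Hj H1 H2 Hx HH) as (u & Hu & Fu).
      now destruct (H3 _ _ Hu Fu).
Qed.

(** * Sums over sets of variables *)

Lemma sumover_zero s f : (forall c, In c s -> f c = 0) -> sumover s f = 0.
Proof.
  induction s as [|c s IH]; intros H; cbn; [easy|].
  rewrite (H c) by now left. apply IH. intros d Hd. apply H. now right.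
Qed.

Lemma sumover_ge s f c : In c s -> f c <= sumover s f.
Proof.
  unfold sumover. induction s as [|d s IH]; [easy|]. cbn. intros [<-|Hc]; [lia|]. specialize (IH Hc). lia.
Qed.

Lemma sumover_le s f g : (forall c, f c <= g c) -> sumover s f <= sumover s g.
Proof.
  intros H. unfold sumover. induction s as [|d s IH]; cbn; [lia|]. specialize (H d). lia.
Qed.

Lemma sumover_Pi_le1 A i s :
  NoDup s ->
  (forall p q, p < length (nth i A []) -> q < length (nth i A []) ->
    In (row_var A i p) s -> In (row_var A i q) s -> p = q) ->
  sumover s (Pi A i) <= 1.
Proof.
  induction 1 as [|c s Hc Hs IH]; intros Huniq; [cbn; lia|].
  change (Pi A i c + sumover s (Pi A i) <= 1).
  destruct (positions A i c) as [|p ps] eqn:E.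
  - rewrite <- length_positions, E. apply IH. intros p q Hp Hq H1 H2.
    apply Huniq; cbn; auto.
  - assert (Hp : In p (positions A i c)) by (rewrite E; now left).
    apply in_positions in Hp as [Hp1 Hp2].
    rewrite sumover_zero.
    + rewrite <- length_positions, Nat.add_0_r. change 1 with (length [p]).
      apply NoDup_incl_length; [apply NoDup_positions|]. intros q Hq.
      apply in_positions in Hq as [Hq1 Hq2]. left. apply Huniq; try assumption; cbn; auto.
    + intros d Hd. rewrite <- length_positions.
      destruct (positions A i d) as [|q qs] eqn:E'; [easy|].
      assert (Hq : In q (positions A i d)) by (rewrite E'; now left).
      apply in_positions in Hq as [Hq1 Hq2].
      assert (p = q) by (apply Huniq; try assumption; cbn; [left | right]; congruence).
      subst q. congruence.
Qed.

(** A row covering no nonempty disjunct needs no cell; any other row has a common full variable, as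
    [no_common_full_var] would separate otherwise. *)
Lemma full_cells A B :
  2 <= length A -> ~ separable A B ->
  exists pk, admissible A B pk /\
    forall l, l < length B -> nth l B [] <> [] -> useful A B pk l.
Proof.
  intros HA Hcon.
  destruct (choice_nat (fun k o => k < length A ->
      match o with
      | Some p => p < length (nth k A []) /\
          forall l, l < length B -> nth l B [] <> [] -> covers A B k l ->
            Omega B l (row_var A k p) = Pi A k (row_var A k p)
      | None => forall l, l < length B -> nth l B [] <> [] -> ~ covers A B k l
      end)) as [pk Hpk].
  { intros k. destruct (classic (exists p, p < length (nth k A []) /\
        forall l, l < length B -> nth l B [] <> [] -> covers A B k l ->
          Omega B l (row_var A k p) = Pi A k (row_var A k p))) as [(p & Hp)|Hno]; [now exists (Some p)|].
    exists None. intros Hk l Hl Hne Hcov. apply Hcon.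
    apply (no_common_full_var A B k l HA Hk Hl Hne Hcov). intros c Hc. apply NNPP. intros Hn.
    apply Hno. rewrite <- length_positions in Hc. destruct (positions A k c) as [|p ps] eqn:E; [cbn in Hc; lia|].
    assert (Hp : In p (positions A k c)) by (rewrite E; now left).
    apply in_positions in Hp as [Hp1 Hp2]. exists p. split; [exact Hp1|].
    intros l' Hl' Hne' Hcov'. rewrite Hp2. apply NNPP. intros Hd. apply Hn. now exists l'. }
  exists pk. split; [split; [now left|]|].
  - intros k p Hk E. specialize (Hpk k Hk). now rewrite E in Hpk.
  - intros l Hl Hne. split; [exact Hne|]. intros k Hk Hcov E. specialize (Hpk k Hk).
    rewrite E in Hpk. now apply (Hpk l).
Qed.

(** * Failure of (S2) and failure of (S1) *)

Lemma empty_cells_admissible A B : admissible A B (fun _ => None).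
Proof. split; [now right | easy]. Qed.

Lemma not_S2_separable A B :
  layout_ok A B -> ~ S2 A B -> ~ Balloon A B -> ~ Lonely A B -> separable A B.
Proof.
  intros HL HS2 HBal HLon. apply NNPP. intros Hcon. pose proof (proj1 HL) as HA.
  destruct (classic (exists l, l < length B /\ forall k, k < length A -> ~ covers A B k l))
    as [(l & Hl & Hnc)|Hall].
  (* No row covers [b_l], so it requests no cells and is useful even with none hidden. All pieces
     turn out empty, and any selection of them wins. *)
  - destruct (survivor_exists A B _ HA (empty_cells_admissible A B) Hcon) as (F & H & HS).
    pose proof (no_outside A B _ F H HL HS (or_intror (fun _ => eq_refl)) HS2) as Hout.
    pose proof (proj1 HS) as (_ & Hsub & _).
    assert (Hempty : forall u x, is_piece A u -> ~ F u x).
    { intros [i p] x Hu HF. destruct (le_lt_dec (length A) x) as [L|L].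
      - apply (Hout x L). eauto.
      - now destruct (survivor_cell _ _ _ _ _ _ _ _ HS Hu HF L). }
    destruct (game_selection A B _ _ F H l 0 [] (proj1 HS)) as (sel & H1 & H2 & H3).
    + constructor.
    + easy.
    + intros c Hc. left. destruct (layout_var A B l c HL Hl Hc) as [_ (u & Hu & E)].
      exists u. repeat split; try assumption; try apply Hu. auto.
    + destruct (survivor_useful _ _ _ _ _ _ _ HS Hl H1 H2) as (i & p & Hp & _ & _ & Hc).
      * split; [|intros k Hk Hc; now destruct (Hnc k Hk)].
        intros E. apply (Hnc 0 HA). intros c. unfold Omega. rewrite E. cbn. lia.
      * exact (Hnc i (proj1 Hp) Hc).
  - assert (Hcov : forall l, l < length B -> exists k, k < length A /\ covers A B k l).
    { intros l Hl. apply NNPP. intros Hn. apply Hall. exists l. split; [exact Hl|].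
      intros k Hk Hc. apply Hn. now exists k. }
    assert (H2A : 2 <= length A).
    { destruct (Nat.eq_dec (length A) 1) as [E|]; [|lia]. exfalso. apply HLon. split; [exact E|].
      intros j Hj. apply (covers_PiGe A B 0 j HL Hj). destruct (Hcov j Hj) as (k & Hk & Hc).
      now replace 0 with k by lia. }
    destruct (full_cells A B H2A Hcon) as (pk & Hadm & Hus).
    destruct (survivor_exists A B pk HA Hadm Hcon) as (F & H & HS).
    pose proof (no_outside A B pk F H HL HS (or_introl Hus) HS2) as Hout.
    pose proof (proj1 HS) as (_ & Hsub & _ & Hdis).
    assert (Hcell : forall i p x, is_piece A (i, p) -> F (i, p) x -> x = i).
    { intros i p x Hp HF. destruct (le_lt_dec (length A) x) as [L|L].
      - destruct (Hout x L). eauto.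
      - now destruct (survivor_cell _ _ _ _ _ _ _ _ HS Hp HF L). }
    (* These variables form the balloon set: without outside addresses, a nonempty piece of row [i]
       contains just cell [i], so each row has at most one. *)
    set (big := fun c => forall u, is_piece A u -> piece_var A u = c -> exists x, F u x).
    set (Bs := filter (fun c => if excluded_middle_informative (big c) then true else false) (Vset A)).
    assert (HBs : forall c, In c Bs <-> In c (Vset A) /\ big c).
    { intros c. unfold Bs. rewrite filter_In. destruct (excluded_middle_informative (big c)); tauto || easy. }
    assert (Hsmall : forall j c, j < length B -> In c (nth j B []) -> ~ In c Bs ->
      exists u, is_piece A u /\ piece_var A u = c /\ forall x, ~ F u x).
    { intros j c Hj Hc Hn. apply NNPP. intros Hx. apply Hn, HBs.
      split; [eapply layout_var; eauto|]. intros u Hu E. apply NNPP. intros Hy. apply Hx.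
      exists u. repeat split; try assumption; try apply Hu. intros x HF. apply Hy. now exists x. }
    assert (HND : NoDup Bs) by apply NoDup_filter, NoDup_nodup.
    assert (Hle1 : forall i, i < length A -> sumover Bs (Pi A i) <= 1).
    { intros i Hi. apply sumover_Pi_le1; [exact HND|]. intros p q Hp Hq H1 H2.
      apply HBs in H1 as [_ H1], H2 as [_ H2].
      destruct (H1 (i, p)) as [x Fx]; [now split | reflexivity|].
      destruct (H2 (i, q)) as [y Fy]; [now split | reflexivity|].
      assert (Ex : x = i) by (apply (Hcell i p); [now split | exact Fx]).
      assert (Ey : y = i) by (apply (Hcell i q); [now split | exact Fy]). subst x y.
      apply (Hdis i p q i); try easy. }
    apply HBal. exists Bs. split; [exact HND|]. split; [apply incl_filter|].
    split; [exact Hle1|]. split.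
    + intros j Hj. destruct (list_eq_dec Nat.eq_dec (nth j B []) []) as [E|Hne].
      { left. apply sumover_zero. intros c _. unfold Omega. now rewrite E. }
      right. destruct (Hcov j Hj) as (k & Hk & Hc).
      pose proof (sumover_le Bs _ _ Hc). specialize (Hle1 k Hk).
      (* A covering row bounds the sum by 1. If it were 0, empty pieces would suffice and leave all
         requested cells. *)
      destruct (Nat.eq_dec (sumover Bs (Omega B j)) 0) as [E0|]; [|lia]. exfalso.
      destruct (game_selection A B _ _ F H j 0 [] (proj1 HS)) as (sel & H1 & H2 & H3).
      * constructor.
      * easy.
      * intros c Hcin. left. apply (Hsmall j c Hj Hcin). intros HcB.
        pose proof (sumover_ge Bs (Omega B j) c HcB). apply Omega_pos in Hcin. lia.
      * destruct (survivor_useful _ _ _ _ _ _ _ HS Hj H1 H2 (Hus j Hj Hne)) as (i & p & _ & Hin & Fp & _).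
        now destruct (H3 _ _ Hin Fp).
    (* Otherwise row [i] has enough pieces of the variables in [Bs], and the other variables have
       empty pieces. Such a selection can remove only cell [i], which [b_j] does not request. *)
    + intros i j [Hi Hj] Hnge. apply NNPP. intros Hn.
      assert (Hnc : ~ covers A B i j) by (intros Hc; now apply Hnge, covers_PiGe).
      assert (Hne : nth j B [] <> []).
      { intros E. apply Hnc. intros c. unfold Omega. rewrite E. cbn. lia. }
      destruct (game_selection A B _ _ F H j i (clean A i []) (proj1 HS)) as (sel & H1 & H2 & H3).
      * apply NoDup_clean.
      * now apply clean_piece.
      * intros c Hc. destruct (in_dec Nat.eq_dec c Bs) as [HcB|HcB]; [right | left; eauto].
        pose proof (clean_count_length A i [] c). cbn in *.
        destruct (le_lt_dec (Omega B j c) (Pi A i c)); [lia|]. exfalso. apply Hn. now exists c.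
      * destruct (survivor_useful _ _ _ _ _ _ _ HS Hj H1 H2 (Hus j Hj Hne)) as (k & p & _ & Hin & Fp & Hc).
        destruct (H3 _ _ Hin Fp) as [E _]. cbn in E. now subst k.
Qed.

Lemma not_S1_separable A B : layout_ok A B -> S2 A B -> ~ S1 A B -> separable A B.
Proof.
  intros HL HS2 HS1. apply NNPP. intros Hcon. pose proof (proj1 HL) as HA. apply HS1.
  intros i j [Hi Hj] Hnge. apply NNPP. intros Hn.
  assert (Hnc : ~ covers A B i j) by (intros Hc; now apply Hnge, covers_PiGe).
  assert (Hne : forall l, l < length B -> nth l B [] <> []).
  { intros l Hl E. destruct (HS2 l Hl) as (c & _ & Hpos & _). unfold Omega in Hpos.
    rewrite E in Hpos. cbn in Hpos. lia. }
  assert (Hpk : exists pk, admissible A B pk /\ good A B pk /\ useful A B pk j).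
  { destruct (le_lt_dec 2 (length A)) as [H2|H1].
    - destruct (full_cells A B H2 Hcon) as (pk & Hadm & Hus). exists pk.
      split; [exact Hadm|]. split; [now left | auto].
    (* The only row is [i], which does not cover [b_j], so [b_j] is useful without hidden cells. *)
    - exists (fun _ => None). split; [apply empty_cells_admissible|]. split; [now right|].
      split; [auto|]. intros k Hk Hc. replace k with i in Hc by lia. easy. }
  destruct Hpk as (pk & Hadm & Hg & Hus).
  destruct (survivor_exists A B pk HA Hadm Hcon) as (F & H & HS).
  destruct (game_selection A B _ _ F H j i (clean A i []) (proj1 HS)) as (sel & H1 & H2 & H3).
  - apply NoDup_clean.
  - now apply clean_piece.
  (* By the choice of [(i, j)] a deficient variable is unbalanced and has an empty piece; the others
     are taken from row [i]. *)
  - intros c Hc. destruct (le_lt_dec (Omega B j c) (Pi A i c)) as [L|L].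
    + right. pose proof (clean_count_length A i [] c). cbn in *. lia.
    + left. apply (unbalanced_empty_piece A B pk F H c HL HS Hg Hne). intros Hb. apply Hn.
      exists c. split; [eapply layout_var; eauto | now split].
  - destruct (survivor_useful _ _ _ _ _ _ _ HS Hj H1 H2 Hus) as (k & p & _ & Hin & Fp & Hc).
    destruct (H3 _ _ Hin Fp) as [E _]. cbn in E. now subst k.
Qed.

Theorem mainTheorem8 (A B : list (list nat)) :
  layout_ok A B ->
  ~ Shadow A B -> ~ Balloon A B -> ~ Lonely A B ->
  exists (phis psis : list assertion),
    length phis = length A /\ length psis = length B /\
    Forall no_avar phis /\ Forall no_avar psis /\
    models 1 (lhs phis A) (rhs psis B) /\
    ~ models 2 (lhs phis A) (rhs psis B).
Proof.
  intros HL HSh HBal HLon. change (separable A B).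
  destruct (classic (S2 A B)) as [H2|H2]; [|now apply not_S2_separable].
  apply not_S1_separable; [exact HL | exact H2|]. intros H1. now apply HSh.
Qed.
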